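(* Let $m,p,n$ be positive integers with $p\mid m$, let $G=G(m,p,n)$ and let $g$ be any element of $G$. Two minimum-length reflection factorizations $f$ and $f'$ of $g$ lie in the same Hurwitz orbit if and only if $G_f=G_{f'}$.
   Context: $G(m,p,n)$ is the group of $n\times n$ complex monomial matrices (exactly one nonzero entry in each row and column) whose nonzero entries are $m$th roots of unity with product an $(m/p)$th root of unity. A reflection of $G$ is an element of $G$ whose fixed space in $\mathbb C^n$ is a hyperplane. A reflection factorization of $g$ is a tuple $f=(t_1,\ldots,t_\ell)$ of reflections in $G$ with $t_1\cdots t_\ell=g$; it is of minimum length if $\ell$ is minimum possible. For such a factorization $f$, $G_f$ denotes the subgroup of $G$ generated by the factors $t_1,\ldots,t_\ell$. The Hurwitz action of the braid group on $\ell$ strands on $\ell$-tuples is generated by the moves $\sigma_i$ that replace $(t_i,t_{i+1})$ by $(t_{i+1},\,t_{i+1}^{-1}t_it_{i+1})$ and leave the other entries unchanged; Hurwitz orbits are the orbits of this action. *)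

(* Defs.v *)
From Stdlib Require Import Relations.
From mathcomp Require Import all_boot all_order all_algebra.
From mathcomp Require Import classical_sets reals complex.
Set Implicit Arguments.
Unset Strict Implicit.
Unset Printing Implicit Defensive.
Import GRing.Theory.
Local Open Scope ring_scope.
Local Open Scope classical_set_scope.

Definition monomial_mx (K : fieldType) (n : nat) (A : 'M[K]_n) : Prop :=
  (forall i, exists! j, A i j != 0) /\ (forall j, exists! i, A i j != 0).

Definition Gmpn (K : fieldType) (m p n : nat) : set 'M[K]_n :=
  [set A | [/\ monomial_mx A,
               forall i j, A i j != 0 -> A i j ^+ m = 1 &
               (\prod_i \prod_(j | A i j != 0) A i j) ^+ (m %/ p) = 1]].
Arguments Gmpn : clear implicits.

(* Matrices act on column vectors by left multiplication; [fixedSpace] is the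
   space of fixed vectors, which is a hyperplane when its codimension is 1. *)
Definition is_reflection (K : fieldType) (n : nat) (A : 'M[K]_n) : Prop :=
  (\dim (fixedSpace (linfun (mulmx A : 'cV[K]_n -> 'cV[K]_n)))).+1 = n.

Definition mx_prod (K : fieldType) (n : nat) (f : seq 'M[K]_n) : 'M[K]_n :=
  \big[mulmx/1%:M]_(t <- f) t.

Definition refl_factorization (K : fieldType) (n : nat) (G : set 'M[K]_n)
    (g : 'M[K]_n) (f : seq 'M[K]_n) : Prop :=
  (forall t, t \in f -> G t /\ is_reflection t) /\ mx_prod f = g.

Definition min_refl_factorization (K : fieldType) (n : nat) (G : set 'M[K]_n)
    (g : 'M[K]_n) (f : seq 'M[K]_n) : Prop :=
  refl_factorization G g f /\
  forall f', refl_factorization G g f' -> (size f <= size f')%N.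

Definition is_subgroup (K : fieldType) (n : nat) (G H : set 'M[K]_n) : Prop :=
  [/\ H `<=` G, H 1%:M,
      forall A B, H A -> H B -> H (A *m B) &
      forall A, H A -> H (invmx A)].

(* [smallest P X] is the intersection of all sets satisfying P and containing
   X. *)
Definition generated_subgroup (K : fieldType) (n : nat) (G : set 'M[K]_n)
    (f : seq 'M[K]_n) : set 'M[K]_n :=
  smallest (is_subgroup G) [set` f].

(* The generator sigma_i, with i = (size s1).+1 *)
Inductive hurwitz_move (K : fieldType) (n : nat) :
    seq 'M[K]_n -> seq 'M[K]_n -> Prop :=
| HurwitzMove (s1 s2 : seq 'M[K]_n) (t u : 'M[K]_n) :
    hurwitz_move (s1 ++ [:: t, u & s2])
                 (s1 ++ [:: u, invmx u *m t *m u & s2]).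

(* On tuples of invertible matrices every sigma_i is a bijection, so the orbits
   of the group they generate are the classes of the equivalence relation
   generated by the moves. *)
Definition same_hurwitz_orbit (K : fieldType) (n : nat) :
    seq 'M[K]_n -> seq 'M[K]_n -> Prop :=
  clos_refl_sym_trans _ (@hurwitz_move K n).

(* Main.v *)
From Stdlib Require Import Relations.
From HB Require Import structures.
Require Import Defs.
From mathcomp Require Import all_boot all_order all_fingroup all_algebra.
From mathcomp Require Import all_solvable all_field zify.
From mathcomp Require Import boolp classical_sets reals complex.
Set Implicit Arguments.
Unset Strict Implicit.
Unset Printing Implicit Defensive.
Import GRing.Theory.

(** The subgroup generated by the entries is constant on an orbit, because a
    move replaces entries by words in the entries ([orbit_generated]).  The
    converse goes as follows.

    A monomial matrix is a permutation of the indices with a weight in Z/m on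
    each arrow.  The reflections are the edges (weighted transpositions) and
    the loops (diagonal matrices with one entry different from 1).  All that is
    used of the subgroup generated by [f] is the groupoid [linked f] of weights
    of paths between indices, which is determined by the subgroup and makes
    sense for the tails that appear in inductions.

    Fix an index [i].  Two neighbouring factors that move [i] in different
    directions can be exchanged for two factors only one of which moves [i].
    So [f] is equivalent to [r ++ h], where the factors of [h] fix [i] and those
    of [r] move it in a common direction ([isolate]).  When [f] has minimum
    length, [r] is empty, a loop, an edge or a double edge ([minimal_vertex]),
    and the product [g] shows which.  If [g] sends some [j] to [i] different
    from [j], then [r] is an edge that [g] determines, the groupoid of [h] is
    the trace of that of [f], and one concludes by induction on the length
    ([hur_of_linked]).

    There remains the case where [g] is diagonal, with weights [a].  A double
    edge from [i] can slide to any index connected to [i] ([slide]).  Once it is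
    removed, what is left is a shortest factorization of another diagonal
    element.  By induction, two shortest factorizations of [g] with the same
    connected components differ, up to moves, by conjugation by a diagonal
    matrix [d] ([hur_diag_conj]).  The [d] for which the conjugate of [f] is
    equivalent to [f] form a group.  It contains the [d] that are constant on
    components; the vectors a_i e_i, by a braid on the double edge at [i]
    ([stable_single]); and (a_i + a_j) (e_i + e_j) for connected [i] and [j], by
    the previous case applied to what remains once the double edge from [i] has
    been slid to [j] ([stable_pair]).  Since Z/m is cyclic, these combine to
    a_j e_i ([stable_cross]).  Finally the weight of a closed path at [i] is
    always in the subgroup generated by the weights of [g] on the component of
    [i] ([exists_potential]).  If the groupoids agree, the differences d_j - d_i
    along a component are in this subgroup, so [d] is in the group above. *)

(** * Hurwitz moves in a group *)

Section Hurwitz.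
Local Open Scope group_scope.
Variable G : groupType.
Implicit Types (t u : G) (f h r s : seq G).

(** The moves make sense in any group.  They are studied on weighted permutations
    and carried over to matrices by [same_orbit_rep]. *)
Inductive braid_move : seq G -> seq G -> Prop :=
| BraidMove s1 s2 t u :
    braid_move (s1 ++ [:: t, u & s2]) (s1 ++ [:: u, t ^ u & s2]).

Definition hurwitz := clos_refl_sym_trans _ braid_move.

Lemma hur_refl f : hurwitz f f. Proof. exact: rst_refl. Qed.

Lemma hur_sym f h : hurwitz f h -> hurwitz h f. Proof. exact: rst_sym. Qed.

Lemma hur_trans f h s : hurwitz f h -> hurwitz h s -> hurwitz f s.
Proof. exact: rst_trans. Qed.

Lemma hur_ind (Q : seq G -> seq G -> Prop) :
    (forall f, Q f f) -> (forall f h, Q f h -> Q h f) ->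
    (forall f h s, Q f h -> Q h s -> Q f s) ->
    (forall s1 s2 t u, Q (s1 ++ [:: t, u & s2]) (s1 ++ [:: u, t ^ u & s2])) ->
  forall f h, hurwitz f h -> Q f h.
Proof.
move=> Qr Qs Qt Qm f h; elim=> {f h} [_ _ [s1 s2 t u]|f|f h _|f h s _ Qfh _].
- exact: Qm.
- exact: Qr.
- exact: Qs.
- exact: Qt.
Qed.

Lemma hur_cat2 s r f h : hurwitz f h -> hurwitz (s ++ f ++ r) (s ++ h ++ r).
Proof.
move: f h; apply: hur_ind => [f|f h|f h u|s1 s2 t u].
- exact: hur_refl.
- exact: hur_sym.
- exact: hur_trans.
- rewrite -!catA !cat_cons [s ++ _]catA [s ++ s1 ++ _]catA.
  exact/rst_step/BraidMove.
Qed.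

Lemma hur_catl s f h : hurwitz f h -> hurwitz (s ++ f) (s ++ h).
Proof. by move/(hur_cat2 s [::]); rewrite !cats0. Qed.

Lemma hur_catr r f h : hurwitz f h -> hurwitz (f ++ r) (h ++ r).
Proof. exact: (hur_cat2 [::] r). Qed.

Lemma hur_move t u : hurwitz [:: t; u] [:: u; t ^ u].
Proof. exact/rst_step/(BraidMove [::] [::]). Qed.

Lemma hur_moveV t u : hurwitz [:: t; u] [:: u ^ t^-1; t].
Proof. by apply: hur_sym; have := hur_move (u ^ t^-1) t; rewrite conjgKV. Qed.

Definition gprod f : G := \prod_(t <- f) t.

Lemma gprod_nil : gprod [::] = 1.
Proof. by rewrite /gprod big_nil. Qed.

Lemma gprod_cons t f : gprod (t :: f) = t * gprod f.
Proof. by rewrite /gprod big_cons. Qed.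

Lemma gprod_cat f h : gprod (f ++ h) = gprod f * gprod h.
Proof. by rewrite /gprod big_cat. Qed.

Lemma gprod1 t : gprod [:: t] = t. Proof. by rewrite /gprod big_seq1. Qed.

Lemma gprod2 t u : gprod [:: t; u] = t * u.
Proof. by rewrite gprod_cons gprod1. Qed.

Lemma hur_gprod f h : hurwitz f h -> gprod f = gprod h.
Proof.
move: f h; apply: hur_ind => // [f h s -> //|s1 s2 t u].
by rewrite !gprod_cat !gprod_cons conjgE !mulgA mulgK.
Qed.

Lemma hur_size f h : hurwitz f h -> size f = size h.
Proof.
by move: f h; apply: hur_ind => // [f h s -> //|s1 s2 t u]; rewrite !size_cat.
Qed.

Definition conjs w f := [seq t ^ w | t <- f].

Lemma hur_conjs w f h : hurwitz f h -> hurwitz (conjs w f) (conjs w h).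
Proof.
move: f h; apply: hur_ind => [f|f h|f h u|s1 s2 t u].
- exact: hur_refl.
- exact: hur_sym.
- exact: hur_trans.
- rewrite /conjs !map_cat /= conjJg; exact/rst_step/BraidMove.
Qed.

Lemma conjs1 f : conjs 1 f = f.
Proof. by rewrite /conjs (eq_map (@conjg1 G)) map_id. Qed.

Lemma conjsM w w' f : conjs (w * w') f = conjs w' (conjs w f).
Proof. by rewrite /conjs -map_comp; apply: eq_map => t; rewrite /= conjgM. Qed.

(** In the inverse move the entry that goes right is left unchanged, so the
    move can be iterated along [s]. *)
Lemma hur_pass_left t s : hurwitz (t :: s) (conjs t^-1 s ++ [:: t]).
Proof.
elim: s => [|u s IHs] /=; first exact: hur_refl.
apply: hur_trans (hur_catr s (hur_moveV t u)) _.
exact: (hur_catl [:: u ^ t^-1] IHs).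
Qed.

Lemma hur_pass_right t s : hurwitz (s ++ [:: t]) (t :: conjs t s).
Proof.
apply: hur_sym; have := hur_pass_left t (conjs t s).
by rewrite -conjsM mulgV conjs1.
Qed.

Lemma hur_block_left s r : hurwitz (r ++ s) (conjs (gprod r)^-1 s ++ r).
Proof.
elim: r => [|t r IHr] /=.
  by rewrite gprod_nil invg1 conjs1 cats0; apply: hur_refl.
apply: hur_trans (hur_catl [:: t] IHr) _.
apply: hur_trans (hur_catr r (hur_pass_left t _)) _.
by rewrite -catA -conjsM gprod_cons invMg; apply: hur_refl.
Qed.

Lemma hur_block_right s r : hurwitz (s ++ r) (r ++ conjs (gprod r) s).
Proof.
apply: hur_sym; have := hur_block_left (conjs (gprod r) s) r.
by rewrite -conjsM mulgV conjs1.
Qed.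

End Hurwitz.

(** * The group of weighted permutations *)

(** The monomial matrices with respect to a group of values, written additively.
    Row [i] of the matrix of [w] has its nonzero entry in column [act w i], with
    the value indexed by [wt w i]; thus products act from left to right. *)
Record mono (I : finType) (A : zmodType) :=
  Mono { mperm : {perm I}; mweight : {ffun I -> A} }.

Section MonoGroup.
Local Open Scope ring_scope.
Variables (I : finType) (A : zmodType).
Local Notation W := (mono I A).
Implicit Types (u v w : W) (i j k : I).

Definition act w i := mperm w i.
Definition wt w i := mweight w i.

Lemma monoP u v : act u =1 act v -> wt u =1 wt v -> u = v.
Proof.
case: u v => [s a] [t b] /= eq_act eq_wt.
by congr Mono; [apply/permP | apply/ffunP].
Qed.

Definition mono_pair w := (mperm w, mweight w).
Definition pair_mono sa : W := Mono sa.1 sa.2.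
Lemma mono_pairK : cancel mono_pair pair_mono. Proof. by case. Qed.
HB.instance Definition _ := Choice.copy W (can_type mono_pairK).

Definition mono_one : W := Mono 1%g 0.
Definition mono_mul u v : W :=
  Mono (mperm u * mperm v)%g [ffun i => wt u i + wt v (act u i)].
Definition mono_inv u : W :=
  Mono (mperm u)^-1%g [ffun i => - wt u ((mperm u)^-1%g i)].

Lemma mono_mulA : associative mono_mul.
Proof.
move=> u v w; apply: monoP => i; rewrite /act /wt /= ?ffunE ?mulgA //.
by rewrite /wt /= !ffunE /act /= permM addrA.
Qed.
Lemma mono_mul1 : left_id mono_one mono_mul.
Proof.
move=> u; apply: monoP => i; rewrite /act /wt /= ?mul1g // !ffunE /wt /=.
by rewrite ffunE add0r /act perm1.
Qed.
Lemma mono_mulr1 : right_id mono_one mono_mul.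
Proof.
move=> u; apply: monoP => i; rewrite /act /wt /= ?mulg1 // !ffunE /wt /=.
by rewrite ffunE addr0.
Qed.
Lemma mono_mulV : left_inverse mono_one mono_inv mono_mul.
Proof.
move=> u; apply: monoP => i; rewrite /act /wt /= ?mulVg // !ffunE /wt /=.
by rewrite ffunE /act /= /wt addNr.
Qed.
Lemma mono_mulrV : right_inverse mono_one mono_inv mono_mul.
Proof.
move=> u; apply: monoP => i; rewrite /act /wt /= ?mulgV // !ffunE /wt /=.
by rewrite ffunE /act /= /wt permK subrr.
Qed.

HB.instance Definition _ := isGroup.Build W
  mono_mulA mono_mul1 mono_mulr1 mono_mulV mono_mulrV.

Lemma act1 i : act (1%g : W) i = i. Proof. by rewrite /act perm1. Qed.
Lemma wt1 i : wt (1%g : W) i = 0. Proof. by rewrite /wt ffunE. Qed.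
Lemma actM u v i : act (u * v)%g i = act v (act u i).
Proof. by rewrite /act permM. Qed.
Lemma wtM u v i : wt (u * v)%g i = wt u i + wt v (act u i).
Proof. by rewrite {1}/wt ffunE. Qed.
Lemma actK u : cancel (act u) (act u^-1%g). Proof. exact: permK. Qed.
Lemma actKV u : cancel (act u^-1%g) (act u). Proof. exact: permKV. Qed.
Lemma act_inj u : injective (act u). Proof. exact: perm_inj. Qed.
Lemma wtV u i : wt u^-1%g i = - wt u (act u^-1%g i).
Proof. by rewrite {1}/wt ffunE. Qed.
Lemma wtVact u i : wt u^-1%g (act u i) = - wt u i.
Proof. by rewrite wtV actK. Qed.

(** The weight [- x] on the way back from [j] makes this an involution, hence a
    reflection. *)
Definition trefl i j x : W :=
  Mono (tperm i j) [ffun k => if k == i then x else if k == j then - x else 0].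

Definition diag (a : {ffun I -> A}) : W := Mono 1%g a.
Definition single i (x : A) : {ffun I -> A} := [ffun k => if k == i then x else 0].
Definition drefl i x : W := diag (single i x).

Lemma act_trefl i j x k : act (trefl i j x) k = tperm i j k.
Proof. by []. Qed.
Lemma wt_trefl i j x k :
  wt (trefl i j x) k = if k == i then x else if k == j then - x else 0.
Proof. by rewrite /wt ffunE. Qed.
Lemma act_diag a k : act (diag a) k = k. Proof. by rewrite /act perm1. Qed.
Lemma wt_diag a k : wt (diag a) k = a k. Proof. by []. Qed.
Lemma wt_drefl i x k : wt (drefl i x) k = if k == i then x else 0.
Proof. by rewrite /wt ffunE. Qed.

Lemma diagD a b : diag (a + b) = (diag a * diag b)%g.
Proof.
apply: monoP => i; first by rewrite actM !act_diag.
by rewrite wtM act_diag !wt_diag ffunE.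
Qed.
Lemma diag0 : diag 0 = 1%g. Proof. by []. Qed.
Lemma diagN a : diag (- a) = (diag a)^-1%g.
Proof.
have e i : act (diag a)^-1%g i = i.
  by apply: (@act_inj (diag a)); rewrite actKV act_diag.
apply: monoP => i; first by rewrite act_diag e.
by rewrite wtV e !wt_diag ffunE.
Qed.

Lemma single_add i x y : single i (x + y) = single i x + single i y.
Proof. by apply/ffunP => k; rewrite !ffunE; case: eqP; rewrite ?addr0. Qed.

Lemma singleN i x : single i (- x) = - single i x.
Proof. by apply/ffunP => k; rewrite !ffunE; case: eqP; rewrite ?oppr0. Qed.

Lemma single0 i : single i 0 = 0.
Proof. by apply/ffunP => k; rewrite !ffunE; case: eqP. Qed.

Lemma trefl_conj i j x w : i != j ->
  (trefl i j x ^ w)%g = trefl (act w i) (act w j) (x + wt w j - wt w i).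
Proof.
move=> ij; apply: monoP => k; rewrite -[k](actKV w); move: (act _ k) => l.
  rewrite conjgE !actM actK !act_trefl.
  case: (tpermP i j l) => [->|->|/eqP li /eqP lj].
  - by rewrite tpermL.
  - by rewrite tpermR.
  - by rewrite tpermD // (inj_eq (@act_inj w)) eq_sym.
rewrite conjgE !wtM !actK wtVact !wt_trefl !(inj_eq (@act_inj w)) act_trefl.
case: (eqVneq l i) => [->|li]; first by rewrite tpermL addrC.
case: (eqVneq l j) => [->|lj]; first by rewrite tpermR !opprD opprK addrCA addrA.
by rewrite tpermD 1?eq_sym // add0r addNr.
Qed.

Lemma drefl_conj i x w : (drefl i x ^ w)%g = drefl (act w i) x.
Proof.
apply: monoP => k; rewrite -[k](actKV w); move: (act _ k) => l.
  by rewrite conjgE !actM actK !act_diag.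
rewrite conjgE !wtM actK act_diag wtVact !wt_drefl (inj_eq (@act_inj w)).
by rewrite addrCA addNr addr0.
Qed.

Lemma treflC i j x : i != j -> trefl i j x = trefl j i (- x).
Proof.
move=> ij; apply: monoP => k; first by rewrite !act_trefl tpermC.
rewrite !wt_trefl opprK; case: (eqVneq k i) => [->|//].
by rewrite (negPf ij).
Qed.

Lemma trefl_mul i j x y : i != j ->
  (trefl i j x * trefl i j y)%g = diag (single i (x - y) + single j (y - x)).
Proof.
move=> ij; apply: monoP => k; first by rewrite actM !act_trefl tpermK act_diag.
rewrite wtM !wt_trefl wt_diag !ffunE act_trefl; case: tpermP => [->|->|].
- by rewrite !eqxx (negPf ij) addr0 eq_sym (negPf ij).
- by rewrite !eqxx eq_sym (negPf ij) add0r addrC.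
- by move=> /eqP/negPf-> /eqP/negPf->; rewrite addr0.
Qed.

Lemma trefl_mulV i j x : i != j -> (trefl i j x)^-1%g = trefl i j x.
Proof.
by move=> ij; apply: mulg1_eq; rewrite trefl_mul // subrr !single0 addr0.
Qed.

Lemma trefl_mul3 i j x y z : i != j ->
  (trefl i j x * trefl i j y * trefl i j z)%g = trefl i j (x - y + z).
Proof.
move=> ij; rewrite trefl_mul //; apply: monoP => k.
  by rewrite actM act_diag.
rewrite wtM act_diag wt_diag !wt_trefl !ffunE.
case: (eqVneq k i) => [->|ki]; first by rewrite (negPf ij) addr0.
case: eqP => // _; last by rewrite !addr0.
by rewrite add0r !opprD opprK [- x + y]addrC.
Qed.

Lemma drefl_mul i x y : (drefl i x * drefl i y)%g = drefl i (x + y).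
Proof. by rewrite -diagD -single_add. Qed.

(** In matrix terms, row and column [i] are those of the identity. *)
Definition fixes i w := (act w i == i) && (wt w i == 0).

Lemma fixesM i u v : fixes i u -> fixes i v -> fixes i (u * v)%g.
Proof.
move=> /andP[/eqP ai /eqP wi] /andP[/eqP bi /eqP zi].
by rewrite /fixes actM wtM ai bi wi zi addr0 !eqxx.
Qed.

Lemma fixesV i u : fixes i u -> fixes i u^-1%g.
Proof.
move=> /andP[/eqP ai /eqP wi].
have bi : act u^-1%g i = i by rewrite -{1}ai actK.
by rewrite /fixes wtV bi wi oppr0 !eqxx.
Qed.

Lemma fixes1 i : fixes i 1%g. Proof. by rewrite /fixes act1 wt1 !eqxx. Qed.

Lemma fixes_diag i a : fixes i (diag a) = (a i == 0).
Proof. by rewrite /fixes act_diag eqxx wt_diag. Qed.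

Lemma fixes_trefl k i j x :
  i != j -> fixes k (trefl i j x) = (k != i) && (k != j).
Proof.
move=> ij; rewrite /fixes act_trefl wt_trefl; case: tpermP => [->|->|].
- by rewrite eq_sym (negPf ij) eqxx.
- by rewrite (negPf ij) eqxx andbF.
- by move=> /eqP/negPf-> /eqP/negPf->; rewrite !eqxx.
Qed.

Lemma fixes_gprod i f : all (fixes i) f -> fixes i (gprod f).
Proof.
elim: f => [|t f IHf] /=; first by rewrite gprod_nil fixes1.
by case/andP=> ti /IHf fi; rewrite gprod_cons fixesM.
Qed.

End MonoGroup.

(** * The groupoid of weighted paths *)

Section Groupoid.
Local Open Scope ring_scope.
Variables (I : finType) (A : zmodType).
Local Notation W := (mono I A).
Implicit Types (t u v w : W) (f h r s : seq W) (i j k : I).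

(** [linked f i j x] holds exactly when some element of the group generated by
    [f] sends [i] to [j] with weight [x].  Paths are used instead of group
    elements because they survive the removal of an index: folding the index onto
    a neighbour sends a path to a path, but not an element to an element. *)
Inductive linked f : I -> I -> A -> Prop :=
| LinkGen t i of t \in f : linked f i (act t i) (wt t i)
| LinkId i : linked f i i 0
| LinkSym i j x of linked f i j x : linked f j i (- x)
| LinkTrans i j k x y of linked f i j x & linked f j k y :
    linked f i k (x + y).

Definition in_groupoid f w := forall i, linked f i (act w i) (wt w i).

Lemma in_groupoid1 f : in_groupoid f 1%g.
Proof. by move=> i; rewrite act1 wt1; apply: LinkId. Qed.

Lemma in_groupoidM f u v :
  in_groupoid f u -> in_groupoid f v -> in_groupoid f (u * v)%g.
Proof. by move=> fu fv i; rewrite actM wtM; apply: LinkTrans. Qed.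

Lemma in_groupoidV f u : in_groupoid f u -> in_groupoid f u^-1%g.
Proof.
by move=> fu i; have := LinkSym (fu (act u^-1%g i)); rewrite actKV wtV.
Qed.

Lemma linked_sub f h :
    (forall t, t \in f -> in_groupoid h t) ->
  forall i j x, linked f i j x -> linked h i j x.
Proof.
move=> fh i j x; elim=> {i j x} [t i /fh|i|i j x _|i j k x y _ hij _ hjk].
- exact.
- exact: LinkId.
- exact: LinkSym.
- exact: LinkTrans hij hjk.
Qed.

Lemma linked_subset f h :
  {subset f <= h} -> forall i j x, linked f i j x -> linked h i j x.
Proof. by move=> fh; apply: linked_sub => t /fh ht i; apply: LinkGen. Qed.

(** Each entry on one side of a move is a word in the entries on the other side. *)
Lemma hur_linked f h i j x :
  hurwitz f h -> linked f i j x <-> linked h i j x.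
Proof.
move=> fh; move: f h fh i j x; apply: hur_ind => //.
- by move=> f h fh i j x; rewrite fh.
- by move=> f h s fh hs i j x; rewrite fh hs.
move=> s1 s2 t u i j x; split; apply: linked_sub => v.
  have u_in : in_groupoid (s1 ++ [:: u, (t ^ u)%g & s2]) u.
    by move=> k; apply: LinkGen; rewrite mem_cat !inE eqxx orbT.
  have tu_in : in_groupoid (s1 ++ [:: u, (t ^ u)%g & s2]) (t ^ u)%g.
    by move=> k; apply: LinkGen; rewrite mem_cat !inE eqxx !orbT.
  rewrite mem_cat !inE; have [v_s1 _ k|_ /=] := boolP (v \in s1).
    by apply: LinkGen; rewrite mem_cat v_s1.
  case/or3P=> [/eqP->|/eqP->|v_s2 k]; [|exact: u_in|].
    rewrite -[X in in_groupoid _ X](conjgK u) (conjgE (t ^ u)%g) invgK.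
    by do 2!apply: in_groupoidM => //; apply: in_groupoidV.
  by apply: LinkGen; rewrite mem_cat !inE v_s2 !orbT.
have u_in : in_groupoid (s1 ++ [:: t, u & s2]) u.
  by move=> k; apply: LinkGen; rewrite mem_cat !inE eqxx !orbT.
have t_in : in_groupoid (s1 ++ [:: t, u & s2]) t.
  by move=> k; apply: LinkGen; rewrite mem_cat !inE eqxx !orbT.
rewrite mem_cat !inE; have [v_s1 _ k|_ /=] := boolP (v \in s1).
  by apply: LinkGen; rewrite mem_cat v_s1.
case/or3P=> [/eqP->|/eqP->|v_s2 k]; first exact: u_in.
  by apply: in_groupoidM; [apply: in_groupoidV | apply: in_groupoidM].
by apply: LinkGen; rewrite mem_cat !inE v_s2 !orbT.
Qed.

Definition connected f i j := exists x, linked f i j x.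

Lemma connected_refl f i : connected f i i.
Proof. by exists 0; apply: LinkId. Qed.

Lemma connected_sym f i j : connected f i j -> connected f j i.
Proof. by case=> x; exists (- x); apply: LinkSym. Qed.

Lemma connected_trans f i j k :
  connected f i j -> connected f j k -> connected f i k.
Proof. by case=> x ij [y jk]; exists (x + y); apply: LinkTrans jk. Qed.

Lemma connected_gen f t i : t \in f -> connected f i (act t i).
Proof. by exists (wt t i); apply: LinkGen. Qed.

Lemma connected_subset f h i j :
  {subset f <= h} -> connected f i j -> connected h i j.
Proof. by move=> fh [x ij]; exists x; apply: linked_subset ij. Qed.

Lemma hur_connected f h i j :
  hurwitz f h -> connected f i j <-> connected h i j.
Proof.
by move=> fh; split=> -[x]; move/(hur_linked _ _ _ fh)=> ij; exists x.
Qed.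

(** When [i] is attached to the rest through [r] only, folding it onto a
    neighbour by [rho] collapses [r] and leaves paths that avoid [i]. *)
Lemma connected_retract (rho : I -> I) r h i a b :
    (forall t k, t \in r -> rho (act t k) = rho k) ->
    (forall k, k != i -> rho k = k) -> all (fixes i) h ->
  connected (r ++ h) a b -> connected h (rho a) (rho b).
Proof.
move=> rho_r rho_id /allP h_i [x].
elim=> {a b x} [t a t_in|a|a b x _|a b c x y _ hab _ hbc].
- have [t_r|t_r] := boolP (t \in r).
    by rewrite rho_r //; apply: connected_refl.
  move: t_in; rewrite mem_cat (negPf t_r) /= => t_h.
  case/andP: (h_i _ t_h) => /eqP ti _; case: (eqVneq a i) => [->|a_i].
    by rewrite ti; apply: connected_refl.
  have ta_i : act t a != i by rewrite -ti (inj_eq (@act_inj _ _ t)).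
  by rewrite !rho_id //; apply: connected_gen.
- exact: connected_refl.
- exact: connected_sym.
- exact: connected_trans hab hbc.
Qed.

(** Here [kappa] records the weight that a path loses at its ends when the leaf
    [i] is folded. *)
Lemma linked_retract (rho : I -> I) (kappa : I -> A) r h i a b x :
    (forall t k, t \in r ->
       rho (act t k) = rho k /\ wt t k = kappa k - kappa (act t k)) ->
    (forall k, k != i -> rho k = k /\ kappa k = 0) -> all (fixes i) h ->
  linked (r ++ h) a b x -> linked h (rho a) (rho b) (x - kappa a + kappa b).
Proof.
move=> rho_r rho_id /allP h_i.
elim=> {a b x} [t a t_in|a|a b x _|a b c x y _ hab _ hbc].
- have [/rho_r-/(_ a)[-> ->]|t_r] := boolP (t \in r).
    by rewrite addrAC subrK subrr; apply: LinkId.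
  move: t_in; rewrite mem_cat (negPf t_r) /= => t_h.
  case/andP: (h_i _ t_h) => /eqP ti /eqP wi; case: (eqVneq a i) => [->|a_i].
    by rewrite ti wi sub0r addNr; apply: LinkId.
  have ta_i : act t a != i by rewrite -ti (inj_eq (@act_inj _ _ t)).
  have [[-> ->] [-> ->]] := (rho_id _ a_i, rho_id _ ta_i).
  by rewrite subr0 addr0; apply: LinkGen.
- by rewrite sub0r addNr; apply: LinkId.
- suff -> : - x - kappa b + kappa a = - (x - kappa a + kappa b) by apply: LinkSym.
  by rewrite !opprD opprK addrAC.
- suff -> : x + y - kappa a + kappa c =
      (x - kappa a + kappa b) + (y - kappa b + kappa c) by apply: LinkTrans hab hbc.
  by rewrite addrA [in RHS]addrACA subrr addr0 [x - kappa a + y]addrAC.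
Qed.

Lemma linked_fixed h i a b x : all (fixes i) h -> linked h a b x ->
  (a == i) = (b == i) /\ (a = i -> x = 0).
Proof.
move=> /allP h_i; elim=> {a b x} [t a t_in|a|a b x _ [e x0]|a b c x y _].
- case/andP: (h_i _ t_in) => /eqP ti /eqP wi.
  by rewrite -[in RHS]ti (inj_eq (@act_inj _ _ t)); split=> // ->.
- by [].
- by split=> // /eqP; rewrite -e => /eqP/x0->; rewrite oppr0.
- case=> e x0 _ [e' y0]; split; first by rewrite e.
  by move=> ai; rewrite x0 // y0 ?addr0 //; apply/eqP; rewrite -e ai.
Qed.

End Groupoid.

(** * Isolating a vertex *)

Lemma constant_or_adjacent (T : Type) (U : eqType) (key : T -> U) (c : U)
    (r : seq T) :
  (exists d, all (fun t => key t == d) r) \/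
  exists r1 t u r2, r = r1 ++ [:: t, u & r2] /\ key t != key u.
Proof.
elim: r => [|t [|u r] IHr]; first by left; exists c.
  by left; exists (key t); rewrite /= eqxx.
case: IHr => [[d rd]|[r1 [v [w [r2 [-> vw]]]]]]; last first.
  by right; exists (t :: r1), v, w, r2.
have [tu|tu] := eqVneq (key t) (key u); last by right; exists [::], t, u, r.
by left; exists d; move: rd; rewrite /= tu => /andP[-> ->].
Qed.

Section Reflections.
Local Open Scope ring_scope.
Variables (I : finType) (A : zmodType) (P : pred A).
Local Notation W := (mono I A).
Implicit Types (t u v w : W) (f h r s : seq W) (i j k : I) (x y : A).

(** The predicate [P] selects the weights that diagonal reflections may have. *)
Definition refl t : Prop :=
  (exists i j x, i != j /\ t = trefl i j x) \/
  (exists i x, [/\ P x, x != 0 & t = drefl i x]).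

Definition refls f := forall t, t \in f -> refl t.

Lemma refls_cons t f : refls (t :: f) <-> refl t /\ refls f.
Proof.
split=> [tf|[Rt Rf] u]; last by rewrite inE => /orP[/eqP->|/Rf].
by split=> [|u uf]; apply: tf; rewrite inE ?eqxx // uf orbT.
Qed.

Lemma refls_cat f h : refls (f ++ h) <-> refls f /\ refls h.
Proof.
split=> [fh|[Rf Rh] u]; last by rewrite mem_cat => /orP[/Rf|/Rh].
by split=> u uf; apply: fh; rewrite mem_cat uf ?orbT.
Qed.

Lemma trefl_refl i j x : i != j -> refl (trefl i j x).
Proof. by left; exists i, j, x. Qed.

Lemma refl_conj t w : refl (t ^ w)%g <-> refl t.
Proof.
suff imp u v : refl u -> refl (u ^ v)%g.
  by split; last exact: imp; move/(imp _ w^-1%g); rewrite conjgK.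
case=> [[i [j [x [ij ->]]]]|[i [x [Px x0 ->]]]].
  by rewrite trefl_conj //; apply: trefl_refl; rewrite (inj_eq (@act_inj _ _ _)).
by rewrite drefl_conj; right; exists (act v i), x.
Qed.

Lemma hur_refls f h : hurwitz f h -> refls f <-> refls h.
Proof.
move: f h; apply: hur_ind => //.
- by move=> f h ->.
- by move=> f h s -> ->.
- move=> s1 s2 t u; rewrite !refls_cat !refls_cons refl_conj; tauto.
Qed.

Lemma fixes_conj i u w : fixes i w -> fixes i (u ^ w)%g = fixes i u.
Proof.
suff imp v t : fixes i t -> fixes i v -> fixes i (v ^ t)%g.
  move=> iw; apply/idP/idP; last exact: imp.
  by move/(imp _ _ (fixesV iw)); rewrite conjgK.
by move=> it iv; rewrite conjgE !fixesM // fixesV.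
Qed.

Definition moves i t := ~~ fixes i t.

(** Factors moving [i] can all be brought to the front: passing over a factor
    that fixes [i] conjugates them by an element fixing [i]. *)
Lemma hur_partition i f : exists r h,
  [/\ hurwitz f (r ++ h), all (moves i) r, all (fixes i) h
    & size r = count (moves i) f].
Proof.
elim: f => [|t f [r [h [frh r_i h_i sz]]]].
  by exists [::], [::]; split=> //; apply: hur_refl.
have tf : hurwitz (t :: f) (t :: r ++ h) by apply: (@hur_catl _ [:: t]).
have [it|it] := boolP (moves i t).
  by exists (t :: r), h; split; rewrite //= ?it ?sz.
exists (conjs t^-1%g r), (t :: h); split.
- apply: hur_trans tf _; rewrite -cat1s catA.
  by have := hur_catr h (hur_pass_left t r); rewrite -!catA.
- rewrite all_map; apply: sub_all r_i => u /=; rewrite /moves.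
  by rewrite fixes_conj // fixesV // -[fixes _ _]negbK.
- by rewrite /= h_i andbT -[fixes _ _]negbK.
- by rewrite size_map sz /= (negPf it).
Qed.

Lemma refl_moves i t : refl t -> moves i t ->
  (exists j x, i != j /\ t = trefl i j x) \/
  (exists x, [/\ P x, x != 0 & t = drefl i x]).
Proof.
case=> [[a [b [x [ab ->]]]]|[a [x [Px x0 ->]]]]; rewrite /moves.
  rewrite fixes_trefl // negb_and !negbK => /orP[/eqP->|/eqP->].
    by left; exists b, x.
  by left; exists a, (- x); rewrite eq_sym -treflC.
rewrite fixes_diag ffunE; case: (eqVneq i a) => [->|]; last by rewrite eqxx.
by right; exists x.
Qed.

(** Two factors moving [i] in different directions can be exchanged for two
    factors only one of which moves [i]: the triangle relation trades the
    edges ij, ik for one of them and jk. *)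
Lemma moves_reduce i t u : refl t -> refl u -> moves i t -> moves i u ->
  act t i != act u i ->
  exists v w, hurwitz [:: t; u] [:: v; w] /\ fixes i v || fixes i w.
Proof.
move=> Rt Ru it iu.
have [[j [x [ij ->]]]|[x [Px x0 ->]]] := refl_moves Rt it;
have [[k [y [ik ->]]]|[y [Py y0 ->]]] := refl_moves Ru iu.
- rewrite !act_trefl !tpermL => jk.
  exists (trefl i k y), (trefl i j x ^ trefl i k y)%g; split.
    exact: hur_move.
  have kj : k != j by rewrite eq_sym.
  by rewrite trefl_conj // !act_trefl tpermL tpermD // (fixes_trefl _ _ kj) ik ij orbT.
- exists (drefl i y ^ (trefl i j x)^-1)%g, (trefl i j x).
  split; first exact: hur_moveV.
  by rewrite drefl_conj trefl_mulV // act_trefl tpermL fixes_diag ffunE (negPf ij) eqxx.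
- exists (trefl i k y), (drefl i x ^ trefl i k y)%g; split; first exact: hur_move.
  by rewrite drefl_conj act_trefl tpermL !fixes_diag ffunE (negPf ik) eqxx orbT.
- by rewrite !act_diag eqxx.
Qed.

(** As long as two consecutive factors at the front disagree on the image of
    [i], [moves_reduce] lowers the number of factors that move [i]. *)
Lemma isolate i f : refls f -> exists j r h,
  [/\ hurwitz f (r ++ h), all (moves i) r, all (fixes i) h
    & all (fun t => act t i == j) r].
Proof.
have [n] := ubnP (count (moves i) f); elim: n f => // n IHn f.
rewrite ltnS => le_n Rf.
have [r [h [frh r_i h_i sz]]] := hur_partition i f.
have [[j rj]|] := constant_or_adjacent (fun t => act t i) i r.
  by exists j, r, h.
case=> [r1 [t [u [r2 [r_def tu]]]]].
have [Rr _] := (refls_cat _ _).1 ((hur_refls frh).1 Rf).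
have t_r : t \in r by rewrite r_def mem_cat !inE eqxx orbT.
have u_r : u \in r by rewrite r_def mem_cat !inE eqxx !orbT.
have [v [w [tuvw vw]]] := moves_reduce (Rr _ t_r) (Rr _ u_r)
  (allP r_i _ t_r) (allP r_i _ u_r) tu.
have f_new : hurwitz f (r1 ++ [:: v; w] ++ r2 ++ h).
  apply: hur_trans frh _; rewrite r_def -catA.
  exact: (hur_cat2 r1 (r2 ++ h) tuvw).
have [||j [r' [h' [new r'_i h'_i r'j]]]] := IHn (r1 ++ [:: v; w] ++ r2 ++ h).
- apply: leq_trans le_n; rewrite -sz r_def !count_cat !size_cat /=.
  have r1_le := count_size (moves i) r1; have r2_le := count_size (moves i) r2.
  have -> : count (moves i) h = 0%N.
    apply/eqP; rewrite eqn0Ngt -has_count; apply/hasPn=> a ah.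
    by rewrite negbK (allP h_i).
  have : (moves i v + moves i w <= 1)%N.
    by case/orP: vw => vw; rewrite /moves vw ?addn0 ?add0n leq_b1.
  lia.
- exact: (hur_refls f_new).1 Rf.
by exists j, r', h'; split=> //; apply: hur_trans f_new _.
Qed.

End Reflections.

(** * Factorizations of minimum length *)

Section Minimal.
Local Open Scope ring_scope.
Variables (I : finType) (A : zmodType) (P : pred A).
Hypothesis P_add : forall x y, P x -> P y -> P (x + y).
Local Notation W := (mono I A).
Local Notation refl := (@refl I A P).
Local Notation refls := (@refls I A P).
Implicit Types (t u v w : W) (f h r s : seq W) (i j k : I) (x y : A).
Implicit Types (a b d : {ffun I -> A}).

Definition minimal f :=
  refls f /\ forall h, refls h -> gprod h = gprod f -> (size f <= size h)%N.

Lemma minimal_hur f h : hurwitz f h -> minimal f -> minimal h.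
Proof.
move=> fh [Rf min_f]; split; first exact: (hur_refls P fh).1.
by move=> s; rewrite -(hur_gprod fh) -(hur_size fh); apply: min_f.
Qed.

Lemma minimal_catr r h : minimal (r ++ h) -> minimal h.
Proof.
case=> [/refls_cat[Rr Rh] min_rh]; split=> // s Rs sh.
rewrite -(leq_add2l (size r)) -!size_cat; apply: min_rh.
  by apply/refls_cat.
by rewrite !gprod_cat sh.
Qed.

Lemma minimal_catl r h : minimal (r ++ h) -> minimal r.
Proof.
case=> [/refls_cat[Rr Rh] min_rh]; split=> // s Rs sh.
rewrite -(leq_add2r (size h)) -!size_cat; apply: min_rh.
  by apply/refls_cat.
by rewrite !gprod_cat sh.
Qed.

Lemma refls_nil : refls [::]. Proof. by []. Qed.

Lemma minimal_neq1 t f : minimal (t :: f) -> gprod (t :: f) != 1%g.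
Proof.
case=> _ min_f; apply/eqP=> f1; have := min_f [::] refls_nil.
by rewrite f1 gprod_nil => /(_ erefl).
Qed.

Variant vertex_form i f : Prop :=
| VertexFixed h of hurwitz f h & all (fixes i) h
| VertexLoop x h of P x & x != 0 & hurwitz f (drefl i x :: h) & all (fixes i) h
| VertexEdge j x h of
    i != j & hurwitz f (trefl i j x :: h) & all (fixes i) h
| VertexPair j x y h of
    i != j & x != y & hurwitz f [:: trefl i j x, trefl i j y & h]
    & all (fixes i) h.

(** After isolating [i], the factors that move it are parallel.  Two loops merge
    into at most one, two equal edges cancel, and three parallel edges have the
    same product as one; minimality excludes all of these. *)
Lemma minimal_vertex i f : minimal f -> vertex_form i f.
Proof.
move=> min_f; have [Rf _] := min_f.
have [j [r [h [frh r_i h_i r_j]]]] := isolate i Rf.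
have min_r : minimal r by apply: (@minimal_catl r h); apply: minimal_hur min_f.
have [Rr le_r] := min_r.
case: r => [|t [|u r]] in frh r_i r_j min_r Rr le_r *.
- exact: VertexFixed frh h_i.
- have [Rt _] := (refls_cons _ _ _).1 Rr; case/andP: r_i => it _.
  have [[k [x [ik tE]]]|[x [Px x0 tE]]] := refl_moves Rt it.
    by rewrite tE in frh; apply: VertexEdge frh h_i.
  by rewrite tE in frh; apply: VertexLoop frh h_i.
have [Rt /refls_cons[Ru Rr']] := (refls_cons _ _ _).1 Rr.
case/and3P: r_i => it iu r_i; case/and3P: r_j => /eqP tj /eqP uj r_j.
have min_tu : minimal [:: t; u] by apply: (@minimal_catl _ r).
have [[k [x [ik tE]]]|[x [Px x0 tE]]] := refl_moves Rt it;
have [[l [y [il uE]]]|[y [Py y0 uE]]] := refl_moves Ru iu.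
- have kj : k = j by rewrite -tj tE act_trefl tpermL.
  have lj : l = j by rewrite -uj uE act_trefl tpermL.
  move: ik il tE uE; rewrite kj lj => ij _ tE uE.
  subst t u; case: r => [|v r] in frh r_i r_j min_r Rr le_r Rr' *.
    apply: VertexPair frh h_i => //; apply: contraNneq (minimal_neq1 min_tu) => ->.
    by rewrite gprod2 trefl_mul // subrr !single0 addr0.
  have [Rv _] := (refls_cons _ _ _).1 Rr'; case/andP: r_i => iv _.
  case/andP: r_j => /eqP vj _.
  have min_tuv : minimal [:: trefl i j x; trefl i j y; v].
    by apply: (@minimal_catl _ r).
  have [[q [z [iq vE]]]|[z [_ _ vE]]] := refl_moves Rv iv; last first.
    by move: vj ij; rewrite vE act_diag => ->; rewrite eqxx.
  have qj : q = j by rewrite -vj vE act_trefl tpermL.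
  subst q v; have [_ /(_ [:: trefl i j (x - y + z)])] := min_tuv.
  rewrite gprod1 gprod_cons gprod2 mulgA trefl_mul3 // => /(_ _ erefl) le31.
  suff /le31 : refls [:: trefl i j (x - y + z)] by [].
  by apply/refls_cons; split=> //; apply: trefl_refl.
- by move: uj tj ik; rewrite uE tE act_diag act_trefl tpermL => -> ->; rewrite eqxx.
- by move: tj uj il; rewrite uE tE act_diag act_trefl tpermL => -> ->; rewrite eqxx.
have := minimal_neq1 min_tu; rewrite gprod2 tE uE drefl_mul => xy0.
have [_ /(_ [:: drefl i (x + y)])] := min_tu.
rewrite gprod1 gprod2 tE uE drefl_mul => /(_ _ erefl) le21.
suff /le21 : refls [:: drefl i (x + y)] by [].
apply/refls_cons; split=> //; right; exists i, (x + y); split=> //.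
  exact: P_add.
by apply: contraNneq xy0 => ->; rewrite /drefl single0 diag0.
Qed.

Lemma act_tail i r h k : all (fixes i) h -> act (gprod r) k = i ->
  act (gprod (r ++ h)) k = i /\ wt (gprod (r ++ h)) k = wt (gprod r) k.
Proof.
move=> /fixes_gprod/andP[/eqP hi /eqP wi] rk.
by rewrite gprod_cat actM wtM rk hi wi addr0.
Qed.

(** Among the shapes of [minimal_vertex] only a single edge is compatible with a
    product sending [j] to [i]; that edge is then the arrow of the product. *)
Lemma minimal_edge i j f : minimal f -> act (gprod f) j = i -> i != j ->
  exists2 h, hurwitz f (trefl i j (- wt (gprod f) j) :: h) & all (fixes i) h.
Proof.
move=> min_f gj ij; have gi : act (gprod f) i != i.
  by rewrite -{2}gj (inj_eq (@act_inj _ _ _)).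
case: (minimal_vertex i min_f) =>
  [h fh h_i|x h _ _ fh h_i|k x h ik fh h_i|k x y h ik _ fh h_i].
- have [|e _] := @act_tail i [::] h i h_i; first by rewrite gprod_nil act1.
  by rewrite (hur_gprod fh) e eqxx in gi.
- have [||e _] := @act_tail i [:: drefl i x] h i => //.
    by rewrite gprod1 act_diag.
  by rewrite (hur_gprod fh) e eqxx in gi.
- have [||e w] := @act_tail i [:: trefl i k x] h k => //.
    by rewrite gprod1 act_trefl tpermR.
  have kj : k = j.
    by apply: (@act_inj _ _ (gprod f)); rewrite gj (hur_gprod fh).
  exists h => //; rewrite -kj (hur_gprod fh) w gprod1 wt_trefl.
  by rewrite eq_sym (negPf ik) eqxx opprK.
- have [||e _] := @act_tail i [:: trefl i k x; trefl i k y] h i => //.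
    by rewrite gprod2 actM !act_trefl tpermK.
  by rewrite (hur_gprod fh) e eqxx in gi.
Qed.

(** * Moving a double edge *)

Lemma fixes_conj_diag i t d : fixes i (t ^ diag d)%g = fixes i t.
Proof.
suff imp v e : fixes i v -> fixes i (v ^ diag e)%g.
  apply/idP/idP; last exact: imp.
  by move/(imp _ (- d)); rewrite diagN conjgK.
case/andP=> /eqP vi /eqP wi; rewrite /fixes conjgE -diagN !actM !wtM.
by rewrite !act_diag vi wi !wt_diag ffunE add0r addNr !eqxx.
Qed.

Lemma mperm_conj_diag t d : mperm (t ^ diag d)%g = mperm t.
Proof.
by apply/permP=> k; rewrite -/(act _ k) conjgE -diagN !actM !act_diag.
Qed.

Lemma map_mperm_conjs d f : map (@mperm I A) (conjs (diag d) f) = map (@mperm I A) f.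
Proof. by rewrite -map_comp; apply: eq_map => t; apply: mperm_conj_diag. Qed.

Lemma all_fixes_conjs i d f : all (fixes i) (conjs (diag d) f) = all (fixes i) f.
Proof. by rewrite all_map; apply: eq_all => t; apply: fixes_conj_diag. Qed.

(** The product of a double edge is diagonal.  Hence the double edge crosses the
    other factors by conjugating them diagonally, which keeps their underlying
    permutations.  Once it is next to the edge [t] from [j] to [k], that edge
    crosses it in turn and carries its end from [j] to [k]. *)
Lemma slide_edge i j k x y h t :
    i != j -> i != k -> j != k -> refls h -> all (fixes i) h ->
    t \in h -> mperm t = tperm j k ->
  exists x' y' h',
    [/\ hurwitz [:: trefl i j x, trefl i j y & h]
                [:: trefl i k x', trefl i k y' & h'],
        all (fixes i) h' & map (@mperm I A) h' = map (@mperm I A) h].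
Proof.
move=> ij ik jk Rh h_i t_h tjk.
have [z tE] : exists z, t = trefl j k z.
  have tj : act t j = k by rewrite /act tjk tpermL.
  have jt : moves j t by rewrite /moves /fixes tj eq_sym (negPf jk).
  have [[l [z [jl tE]]]|[z [_ _ tE]]] := refl_moves (Rh _ t_h) jt.
    by exists z; move: tj; rewrite tE act_trefl tpermL => ->.
  by move: tj jk; rewrite tE act_diag => ->; rewrite eqxx.
case/splitPr: t_h Rh h_i => s r Rh; rewrite all_cat /= => /and3P[s_i ti r_i].
set p := [:: trefl i j x; trefl i j y].
have [d pd] : exists d, gprod p = diag d.
  by rewrite gprod2 trefl_mul //; exists (single i (x - y) + single j (y - x)).
pose p' := conjs t p.
have pE : p' = [:: trefl i k (x + z); trefl i k (y + z)].
  rewrite /p' /= !trefl_conj // tE !act_trefl tpermL tpermD // 1?eq_sym //.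
  by rewrite !wt_trefl eqxx (negPf ij) (negPf ik) !subr0.
have [d' pd'] : exists d', gprod p' = diag d'.
  rewrite pE gprod2 trefl_mul //.
  by exists (single i (x + z - (y + z)) + single k (y + z - (x + z))).
exists (x + z), (y + z), (conjs (diag d') (conjs (diag (- d)) s ++ [:: t]) ++ r).
split.
- apply: (@hur_trans _ _ (conjs (diag (- d)) s ++ [:: t] ++ p' ++ r)).
    apply: (@hur_trans _ _ (conjs (diag (- d)) s ++ p ++ [:: t] ++ r)).
      rewrite diagN -pd; have := hur_catr (t :: r) (hur_block_left s p).
      by rewrite -!catA.
    by apply: hur_catl; have := hur_catr r (hur_pass_right t p); rewrite -!catA.
  have := hur_catr r (hur_block_right (conjs (diag (- d)) s ++ [:: t]) p').
  by rewrite pd' pE -!catA.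
- by rewrite all_cat all_fixes_conjs all_cat all_fixes_conjs s_i /= ti.
- by rewrite !map_cat map_mperm_conjs map_cat map_mperm_conjs /= -catA.
Qed.

Lemma slide i j k x y h :
    i != j -> i != k -> refls h -> all (fixes i) h -> connected h j k ->
  exists x' y' h',
    hurwitz [:: trefl i j x, trefl i j y & h]
            [:: trefl i k x', trefl i k y' & h'] /\ all (fixes i) h'.
Proof.
move=> ij ik Rh h_i [c jk].
(* Only the underlying permutations of the tail survive a slide, so the
   property that is propagated along paths has to hold for every tail [h0] with
   the same permutations as [h]. *)
pose slides j k := i != j -> forall x y h0,
  refls h0 -> all (fixes i) h0 -> map (@mperm I A) h0 = map (@mperm I A) h ->
  exists x' y' h',
    [/\ hurwitz [:: trefl i j x, trefl i j y & h0]
                [:: trefl i k x', trefl i k y' & h'],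
        all (fixes i) h' & map (@mperm I A) h' = map (@mperm I A) h].
suff [slides_jk _] : slides j k /\ slides k j.
  have [x' [y' [h' [hh' h'_i _]]]] := slides_jk ij x y h Rh h_i erefl.
  by exists x', y', h'.
have slide_refl l : slides l l.
  by move=> _ x0 y0 h0 _ h0_i e; exists x0, y0, h0; split=> //; apply: hur_refl.
have slide_trans l m n : (i == l) = (i == m) ->
    slides l m -> slides m n -> slides l n.
  move=> e lm mn il x0 y0 h0 R0 h0_i e0.
  have [x1 [y1 [h1 [h01 h1_i e1]]]] := lm il x0 y0 h0 R0 h0_i e0.
  have im : i != m by rewrite -e.
  have R1 : refls h1.
    have : refls [:: trefl i m x1, trefl i m y1 & h1].
      apply: (hur_refls P h01).1.
      by do 2!(apply/refls_cons; split; first exact: trefl_refl).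
    by case/refls_cons=> _ /refls_cons[].
  have [x2 [y2 [h2 [h12 h2_i e2]]]] := mn im x1 y1 h1 R1 h1_i e1.
  by exists x2, y2, h2; split=> //; apply: hur_trans h01 h12.
have slide_step l m : i != m -> tperm l m \in map (@mperm I A) h -> slides l m.
  move=> im lm_h il x0 y0 h0 R0 h0_i e0; have [<-|lm] := eqVneq l m.
    exact: slide_refl.
  move: lm_h; rewrite -e0 => /mapP[t t_h0 tE].
  have [x1 [y1 [h1 [? ? e1]]]] := slide_edge x0 y0 il im lm R0 h0_i t_h0 (esym tE).
  by exists x1, y1, h1; rewrite e1.
elim: jk {ij ik} => {j k c} [t j t_h|j|j k c _ []|j k l c e jk [sjk skj] kl [skl slk]] //.
- have [tj|tj] := eqVneq (act t j) j; first by rewrite tj.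
  have jt : moves j t by rewrite /moves /fixes (negPf tj).
  have [[k [z [jk tE]]]|[z [_ _ tE]]] := refl_moves (Rh _ t_h) jt; last first.
    by rewrite tE act_diag eqxx in tj.
  have := allP h_i _ t_h; rewrite tE fixes_trefl // => /andP[ij ik].
  have jk_h : tperm j k \in map (@mperm I A) h by apply/mapP; exists t; rewrite // tE.
  by rewrite act_trefl tpermL; split; apply: slide_step; rewrite // tpermC.
- have [e1 _] := linked_fixed h_i jk; have [e2 _] := linked_fixed h_i kl.
  by split; [apply: slide_trans sjk skl | apply: slide_trans slk skj];
    rewrite ![i == _]eq_sym ?e1 ?e2.
Qed.

End Minimal.

(** * Factorizations of diagonal elements *)

Section Diagonal.
Local Open Scope ring_scope.
Variables (I : finType) (A : zmodType) (P : pred A).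
Hypothesis P_add : forall x y, P x -> P y -> P (x + y).
Local Notation W := (mono I A).
Local Notation minimal := (@minimal I A P).
Implicit Types (t u v w : W) (f h r s : seq W) (i j k l : I) (x y c : A).
Implicit Types (a d : {ffun I -> A}).

Definition fold i j k := if k == i then j else k.

Lemma fold_id i k : fold i i k = k.
Proof. by rewrite /fold; case: eqP. Qed.

Lemma fold_trefl i j x k : fold i j (act (trefl i j x) k) = fold i j k.
Proof.
rewrite /fold act_trefl; case: (tpermP i j k) => [->|->|//].
  by rewrite eqxx; case: eqP.
by rewrite eqxx; case: (eqVneq j i) => [->|].
Qed.

Lemma connected_fixed i h k : all (fixes i) h -> connected h i k -> k = i.
Proof.
by move=> h_i [x] /(linked_fixed h_i)[]; rewrite eqxx => /esym/eqP.
Qed.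

(** Contracting the edge from [i] to [j] makes [r] act trivially on the indices. *)
Definition folded i j r := forall t k, t \in r -> fold i j (act t k) = fold i j k.

Lemma folded_pair i j x y : folded i j [:: trefl i j x; trefl i j y].
Proof. by move=> t k; rewrite !inE => /orP[]/eqP->; rewrite fold_trefl. Qed.

Lemma folded_loop i x : folded i i [:: drefl i x].
Proof. by move=> t k; rewrite !inE => /eqP->; rewrite act_diag. Qed.

Lemma connected_fold i j r h k l : folded i j r -> all (fixes i) h ->
  connected (r ++ h) k l -> connected h (fold i j k) (fold i j l).
Proof.
move=> r_ij h_i; apply: connected_retract h_i => [t m t_r|m /negPf mi].
  exact: r_ij.
by rewrite /fold mi.
Qed.

Lemma sub_connected_tail i j r r' h h' : folded i j r' ->
    all (fixes i) h -> all (fixes i) h' ->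
    (forall k l, connected (r ++ h) k l -> connected (r' ++ h') k l) ->
  forall k l, connected h k l -> connected h' k l.
Proof.
move=> r'_ij h_i h'_i sub k l hkl.
have [e|ki] := eqVneq k i.
  move: hkl; rewrite e => /(connected_fixed h_i) ->; exact: connected_refl.
have [e|li] := eqVneq l i.
  move: hkl ki; rewrite e => /connected_sym/(connected_fixed h_i) ->.
  by rewrite eqxx.
have := @connected_fold i j r' h' k l r'_ij h'_i.
rewrite /fold (negPf ki) (negPf li); apply; apply: sub.
by apply: connected_subset hkl => t; rewrite mem_cat orbC => ->.
Qed.

Lemma pair_weight i j x y h a : i != j -> all (fixes i) h ->
  gprod [:: trefl i j x, trefl i j y & h] = diag a -> a i = x - y.
Proof.
move=> ij h_i e; have [|_] := @act_tail _ _ i [:: trefl i j x; trefl i j y] h i h_i.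
  by rewrite gprod2 actM !act_trefl tpermK.
rewrite /= e wt_diag => ->; rewrite gprod2 trefl_mul // wt_diag !ffunE eqxx.
by rewrite (negPf ij) addr0.
Qed.

(** The product of the double edge is diagonal with weights a_i at [i] and - a_i
    at [j], so removing it transfers the weight of [i] to [j]. *)
Lemma pair_tail i j x y h a : i != j -> all (fixes i) h ->
    gprod [:: trefl i j x, trefl i j y & h] = diag a ->
  gprod h = diag (a - single i (a i) + single j (a i)).
Proof.
move=> ij h_i e; have ai := pair_weight ij h_i e.
move: e; rewrite !gprod_cons mulgA trefl_mul // -ai -[y - x]opprB -ai => e.
apply: (mulgI (diag (single i (a i) + single j (- a i)))); rewrite e -diagD.
congr diag; rewrite addrACA -single_add addNr single0 addr0.
by rewrite addrC subrK.
Qed.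

Lemma loop_weight i x h a : all (fixes i) h ->
  gprod (drefl i x :: h) = diag a -> a i = x.
Proof.
move=> h_i e; have [|_] := @act_tail _ _ i [:: drefl i x] h i h_i.
  by rewrite gprod1 act_diag.
by rewrite /= e wt_diag => ->; rewrite gprod1 wt_drefl eqxx.
Qed.

Lemma loop_tail i x h a : all (fixes i) h ->
  gprod (drefl i x :: h) = diag a -> gprod h = diag (a - single i (a i)).
Proof.
move=> h_i e; have ai := loop_weight h_i e.
move: e; rewrite !gprod_cons => e.
by apply: (mulgI (drefl i x)); rewrite e -diagD -ai addrC subrK.
Qed.

Lemma fixed_weight i h a : all (fixes i) h -> gprod h = diag a -> a i = 0.
Proof. by move=> /fixes_gprod/andP[_ /eqP hi] e; rewrite -hi e. Qed.

Lemma edge_not_diag i j x h a :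
  i != j -> all (fixes i) h -> gprod (trefl i j x :: h) <> diag a.
Proof.
move=> ij h_i e; have [|+ _] := @act_tail _ _ i [:: trefl i j x] h j h_i.
  by rewrite gprod1 act_trefl tpermR.
by rewrite /= e act_diag => ji; rewrite ji eqxx in ij.
Qed.

Variant diag_vertex_form i f (a : {ffun I -> A}) : Prop :=
| DiagFixed h of a i = 0 & hurwitz f h & all (fixes i) h
| DiagLoop h of a i != 0 & hurwitz f (drefl i (a i) :: h) & all (fixes i) h
| DiagPair j x h of a i != 0 & i != j
    & hurwitz f [:: trefl i j x, trefl i j (x - a i) & h] & all (fixes i) h.

Lemma minimal_diag_vertex i f a :
  minimal f -> gprod f = diag a -> diag_vertex_form i f a.
Proof.
move=> min_f fa; case: (minimal_vertex P_add i min_f).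
- move=> h fh h_i; apply: (@DiagFixed _ _ _ h) => //.
  by apply: (fixed_weight h_i); rewrite -(hur_gprod fh).
- move=> x h _ x0 fh h_i; rewrite (hur_gprod fh) in fa.
  by have ai := loop_weight h_i fa; apply: (@DiagLoop _ _ _ h); rewrite ?ai.
- move=> j x h ij fh h_i; rewrite (hur_gprod fh) in fa.
  by case: (edge_not_diag ij h_i fa).
- move=> j x y h ij xy fh h_i; rewrite (hur_gprod fh) in fa.
  have ai := pair_weight ij h_i fa; apply: (@DiagPair _ _ _ j x h) => //.
    by rewrite ai subr_eq0.
  by rewrite ai subKr.
Qed.

Lemma connected_pair i k f a :
    minimal f -> gprod f = diag a -> i != k -> connected f i k ->
  exists x h, hurwitz f [:: trefl i k x, trefl i k (x - a i) & h]
              /\ all (fixes i) h.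
Proof.
move=> min_f fa ik fik; case: (minimal_diag_vertex i min_f fa).
- move=> h _ fh h_i; move/(hur_connected _ _ fh)/(connected_fixed h_i): fik ik => ->.
  by rewrite eqxx.
- move=> h _ fh h_i; move/(hur_connected _ _ fh): fik ik.
  move/(@connected_fold i i [:: _] h _ _ (@folded_loop _ _) h_i).
  by rewrite !fold_id => /(connected_fixed h_i)->; rewrite eqxx.
move=> j x h _ ij fh h_i; have [Rf _] := minimal_hur fh min_f.
have /refls_cons[_ /refls_cons[_ Rh]] := Rf.
move/(hur_connected _ _ fh): fik.
move/(@connected_fold i j [:: _; _] h _ _ (@folded_pair _ _ _ _) h_i).
rewrite /fold eqxx eq_sym (negPf ik) => hjk.
have [x' [y' [h' [hh' h'_i]]]] := slide x (x - a i) ij ik Rh h_i hjk.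
have e := hur_gprod hh'; rewrite -(hur_gprod fh) fa in e.
exists x', h'; split=> //; apply: (hur_trans fh).
by have -> : x' - a i = y' by rewrite (pair_weight ik h'_i (esym e)) subKr.
Qed.

(** * Comparing factorizations up to diagonal conjugation *)

Lemma trefl_conj_diag i j x d :
  i != j -> (trefl i j x ^ diag d)%g = trefl i j (x + d j - d i).
Proof. by move=> ij; rewrite trefl_conj // !act_diag !wt_diag. Qed.

Lemma drefl_conj_diag i x d : (drefl i x ^ diag d)%g = drefl i x.
Proof. by rewrite drefl_conj act_diag. Qed.

Lemma conjs_single i c h : all (fixes i) h -> conjs (drefl i c) h = h.
Proof.
move=> /allP h_i; rewrite -[RHS]map_id; apply/eq_in_map => t /h_i.
case/andP=> /eqP ti _; apply/conjg_fixP/commgP.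
by rewrite /commute [RHS]conjgC drefl_conj ti.
Qed.

Lemma conjs_off i d d' h :
    all (fixes i) h -> (forall k, k != i -> d k = d' k) ->
  conjs (diag d) h = conjs (diag d') h.
Proof.
move=> h_i dd'; have -> : d = d' + single i (d i - d' i).
  apply/ffunP=> k; rewrite !ffunE; have [->|/dd'->] := eqVneq k i.
    by rewrite addrC subrK.
  by rewrite addr0.
by rewrite diagD conjsM conjs_single // all_fixes_conjs.
Qed.

Lemma minimal_diag_nil f : minimal f -> gprod f = 1%g -> f = [::].
Proof.
case: f => // t f min_f f1; have := minimal_neq1 min_f.
by rewrite f1 eqxx.
Qed.

Lemma exists_weight f a :
  minimal f -> gprod f = diag a -> f != [::] -> exists i, a i != 0.
Proof.
move=> min_f fa f0; apply/existsP; apply: contraNT f0; rewrite negb_exists.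
move=> /forallP a0; apply/eqP/(minimal_diag_nil min_f); rewrite fa -diag0.
by congr diag; apply/ffunP=> i; rewrite ffunE; apply/eqP; have := a0 i; rewrite negbK.
Qed.

(** Isolate an index [i] of nonzero weight in both factorizations; sliding makes
    the two double edges end at the same [j].  The tails are then conjugate by
    induction, and the tails do not depend on the entry of [d] at [i], which is
    left free to match the double edges. *)
Lemma hur_diag_conj f f' a :
    minimal f -> minimal f' -> gprod f = diag a -> gprod f' = diag a ->
    (forall i j, connected f i j <-> connected f' i j) ->
  exists d, hurwitz f' (conjs (diag d) f).
Proof.
have [n] := ubnP (size f); elim: n f f' a => // n IHn f f' a.
rewrite ltnS => le_n min_f min_f' fa f'a cff'.
have [f0|f0] := eqVneq f [::].
  exists 0; rewrite diag0 conjs1 f0; suff -> : f' = [::] by apply: hur_refl.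
  by apply: minimal_diag_nil => //; rewrite f'a -fa f0 gprod_nil.
have [i ai] := exists_weight min_f fa f0.
have tails j r r' h h' : folded i j r -> folded i j r' -> r != [::] ->
    all (fixes i) h -> all (fixes i) h' -> (exists d, gprod h = diag d) ->
    gprod h = gprod h' -> hurwitz f (r ++ h) -> hurwitz f' (r' ++ h') ->
  exists d, hurwitz h' (conjs (diag d) h).
- move=> r_ij r'_ij r0 h_i h'_i [d hd] hh' fh fh'; apply: (IHn h h' d) => //.
  + apply: leq_trans le_n; rewrite (hur_size fh) size_cat.
    by rewrite -[X in (X < _)%N]add0n ltn_add2r lt0n size_eq0.
  + exact: minimal_catr (minimal_hur fh min_f).
  + exact: minimal_catr (minimal_hur fh' min_f').
  + by rewrite -hh'.
  + move=> k l; split.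
      apply: (sub_connected_tail r'_ij h_i h'_i) => k' l'.
      move/(hur_connected _ _ fh)=> /cff'; exact: (hur_connected _ _ fh').1.
    apply: (sub_connected_tail r_ij h'_i h_i) => k' l'.
    move/(hur_connected _ _ fh')=> /cff'; exact: (hur_connected _ _ fh).1.
case: (minimal_diag_vertex i min_f fa) => [h ai0|h _ fh h_i|j x h _ ij fh h_i].
- by rewrite ai0 eqxx in ai.
- case: (minimal_diag_vertex i min_f' f'a) =>
    [h' ai0|h' _ fh' h'_i|j x h' _ ij fh' h'_i].
  + by rewrite ai0 eqxx in ai.
  + have [hd h'd] : gprod h = diag (a - single i (a i)) /\
                    gprod h' = diag (a - single i (a i)).
      split; first exact: loop_tail h_i (etrans (esym (hur_gprod fh)) fa).
      exact: loop_tail h'_i (etrans (esym (hur_gprod fh')) f'a).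
    have [||d dP] := tails i [:: drefl i (a i)] [:: drefl i (a i)] h h'
      (@folded_loop _ _) (@folded_loop _ _) isT h_i h'_i _ _ fh fh'.
    + by exists (a - single i (a i)).
    + by rewrite hd h'd.
    exists d; apply: (hur_trans fh'); apply: hur_trans (hur_conjs _ (hur_sym fh)).
    by rewrite /= drefl_conj_diag; apply: (@hur_catl _ [:: _]).
  + have : connected f i j.
      apply/cff'/(hur_connected _ _ fh'); have := @connected_gen _ _
        [:: trefl i j x, trefl i j (x - a i) & h'] (trefl i j x) i.
      by rewrite act_trefl tpermL inE eqxx; apply.
    move/(hur_connected _ _ fh).
    move/(@connected_fold i i [:: _] h _ _ (@folded_loop _ _) h_i).
    rewrite !fold_id => /(connected_fixed h_i) ji.
    by rewrite ji eqxx in ij.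
have fij : connected f i j.
  apply/(hur_connected _ _ fh); have := @connected_gen _ _
    [:: trefl i j x, trefl i j (x - a i) & h] (trefl i j x) i.
  by rewrite act_trefl tpermL inE eqxx; apply.
have [x' [h' [fh' h'_i]]] := connected_pair min_f' f'a ij ((cff' _ _).1 fij).
have [hd h'd] : gprod h = diag (a - single i (a i) + single j (a i)) /\
                gprod h' = diag (a - single i (a i) + single j (a i)).
  split; first exact: pair_tail ij h_i (etrans (esym (hur_gprod fh)) fa).
  exact: pair_tail ij h'_i (etrans (esym (hur_gprod fh')) f'a).
have [||d dP] := tails j [:: trefl i j x; trefl i j (x - a i)]
  [:: trefl i j x'; trefl i j (x' - a i)] h h'
  (@folded_pair _ _ _ _) (@folded_pair _ _ _ _) isT h_i h'_i _ _ fh fh'.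
- by exists (a - single i (a i) + single j (a i)).
- by rewrite hd h'd.
pose d' : {ffun I -> A} := [ffun k => if k == i then d j + (x - x') else d k].
exists d'; apply: (hur_trans fh'); apply: hur_trans (hur_conjs _ (hur_sym fh)).
rewrite /= !trefl_conj_diag // !ffunE eqxx eq_sym (negPf ij).
have xE y : y + d j - (d j + (x - x')) = y - x + x'.
  by rewrite opprD opprB addrA addrK addrA addrAC.
rewrite !xE subrr add0r [x - a i - x]addrAC subrr sub0r [- a i + _]addrC.
apply: (@hur_catl _ [:: _; _]); rewrite (@conjs_off i d' d) //.
by move=> k /negPf ki; rewrite ffunE ki.
Qed.

End Diagonal.

(** * Diagonal conjugations realized by braids *)

Section Stabilizer.
Local Open Scope ring_scope.
Variables (I : finType) (A : zmodType) (P : pred A).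
Hypothesis P_add : forall x y, P x -> P y -> P (x + y).
Local Notation W := (mono I A).
Local Notation minimal := (@minimal I A P).
Implicit Types (t u v w : W) (f h r s : seq W) (i j k l : I) (x y c : A).
Implicit Types (a d : {ffun I -> A}).

(** For fixed [f] these [d] form a group, as diagonal matrices commute. *)
Definition conj_stable f d := hurwitz f (conjs (diag d) f).

Lemma stable_hur f h d : hurwitz f h -> conj_stable h d -> conj_stable f d.
Proof.
move=> fh hd; apply: (hur_trans fh); apply: (hur_trans hd).
exact: hur_conjs (hur_sym fh).
Qed.

Lemma stable0 f : conj_stable f 0.
Proof. by rewrite /conj_stable diag0 conjs1; apply: hur_refl. Qed.

Lemma stableD f d d' :
  conj_stable f d -> conj_stable f d' -> conj_stable f (d + d').
Proof.
move=> fd fd'; rewrite /conj_stable diagD conjsM.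
exact: hur_trans fd' (hur_conjs _ fd).
Qed.

Lemma stableN f d : conj_stable f d -> conj_stable f (- d).
Proof.
move=> fd; have := hur_conjs (diag (- d)) fd.
by rewrite -conjsM -diagD subrr diag0 conjs1 => /hur_sym.
Qed.

Lemma stableMz f d (m : int) : conj_stable f d -> conj_stable f (d *~ m).
Proof.
move=> fd; have nat n : conj_stable f (d *+ n).
  elim: n => [|n IHn]; first exact: stable0.
  by rewrite mulrS; apply: stableD.
by case: m => n; [apply: nat | apply: stableN; apply: nat].
Qed.

(** Exchanging the two parallel edges of the double edge at [i] shifts both of
    their weights by - a_i, and conjugation by a_i e_i does the same. *)
Lemma stable_single i f a :
  minimal f -> gprod f = diag a -> conj_stable f (single i (a i)).
Proof.
move=> min_f fa; case: (minimal_diag_vertex P_add i min_f fa).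
- move=> h _ fh h_i; apply: (stable_hur fh).
  by rewrite /conj_stable -/(drefl _ _) conjs_single //; apply: hur_refl.
- move=> h _ fh h_i; apply: (stable_hur fh).
  rewrite /conj_stable -/(drefl _ _) /= drefl_conj_diag.
  by rewrite -/(conjs _ _) conjs_single //; apply: hur_refl.
move=> j x h _ ij fh h_i; apply: (stable_hur fh).
rewrite /conj_stable -/(drefl _ _) /= -/(conjs _ _) conjs_single //.
rewrite !trefl_conj_diag // !ffunE eqxx [j == i]eq_sym (negPf ij) !addr0.
set y := x - a i.
have <- : (trefl i j x ^ trefl i j y)%g = trefl i j (y - a i).
  rewrite trefl_conj // !act_trefl tpermL tpermR !wt_trefl !eqxx eq_sym (negPf ij).
  rewrite treflC 1?eq_sym //; congr trefl.
  by rewrite !opprD !opprK addrC [- x + y]addrC /y [x - _ - x]addrAC subrr sub0r.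
exact: (@hur_catr _ h _ _ (hur_move _ _)).
Qed.

(** Slide the double edge from [i] to [j].  Conjugation by a multiple of e_i + e_j
    does not affect it, and on the tail, whose weight at [j] is a_i + a_j and
    which fixes [i], the claim is [stable_single] at [j]. *)
Lemma stable_pair i j f a : i != j -> connected f i j ->
    minimal f -> gprod f = diag a ->
  conj_stable f (single i (a i + a j) + single j (a i + a j)).
Proof.
move=> ij fij min_f fa; set c := a i + a j.
have [x [h [fh h_i]]] := connected_pair P_add min_f fa ij fij.
apply: (stable_hur fh); have min_h : minimal h.
  by apply: (@minimal_catr _ _ _ [:: _; _]); apply: minimal_hur fh min_f.
have ha := pair_tail ij h_i (etrans (esym (hur_gprod fh)) fa).
have := stable_single j min_h ha; rewrite /conj_stable /= !trefl_conj_diag //.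
rewrite !ffunE !eqxx [j == i]eq_sym (negPf ij) !subr0 !addr0 !add0r.
rewrite [a j + _]addrC -/c !addrK => hj; apply: (@hur_catl _ [:: _; _]).
apply: (hur_trans hj); rewrite -/(conjs _ _).
rewrite (@conjs_off _ _ i (single i c + single j c) (single j c)) //.
  exact: hur_refl.
by move=> k /negPf ki; rewrite !ffunE ki add0r.
Qed.

Lemma singleMz i x (m : int) : single i (x *~ m) = single i x *~ m :> {ffun I -> A}.
Proof.
have nat n : single i (x *+ n) = single i x *+ n :> {ffun I -> A}.
  elim: n => [|n IHn]; first exact: single0.
  by rewrite !mulrS single_add IHn.
by case: m => n; rewrite ?NegzE ?mulrNz ?singleN -?pmulrn nat.
Qed.

Hypothesis bezout : forall x y, exists z (p q m n : int),
  [/\ x = z *~ p, y = z *~ q & z = x *~ m + y *~ n].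

(** For v = v_i e_i + v_j e_j put a(v) = v_i a_i + v_j a_j.  The two previous
    lemmas say that a(v) v is stable for v = e_i, e_j and e_i + e_j.  These values
    generate those at all integral v and those of the polarization
    a(v) w + a(w) v, which are therefore stable.  Choose v = (m, n) such that
    a(v) = z generates the subgroup spanned by a_i and a_j.  With w = e_i this makes z e_i + a_i v stable, where
    a_i v is a multiple of a(v) v. *)
Lemma stable_cross i j f a : connected f i j ->
  minimal f -> gprod f = diag a -> conj_stable f (single i (a j)).
Proof.
move=> fij min_f fa; have [->|ij] := eqVneq i j; first exact: stable_single min_f fa.
have ii := stable_single i min_f fa; have jj := stable_single j min_f fa.
have := stable_pair ij fij min_f fa; rewrite !single_add.
set M := single i (a j) + single j (a i).
have -> : single i (a i) + single i (a j) + (single j (a i) + single j (a j)) =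
    M + (single i (a i) + single j (a j)).
  by rewrite [single i _ + single i _]addrC addrACA.
move=> /stableD/(_ (stableN (stableD ii jj))); rewrite addrK => ij_stable.
have [z [p [q [m [n [ai aj ze]]]]]] := bezout (a i) (a j).
suff z_stable : conj_stable f (single i z).
  by rewrite aj singleMz; apply: stableMz.
have -> : single i z = single i (a i) *~ (m *+ 2) + M *~ n
   - (single i (a i) *~ (m * m) + single j (a j) *~ (n * n) + M *~ (m * n)) *~ p.
  have zm : a i *~ (m * m) + a j *~ (m * n) = z *~ m.
    by rewrite [(m * n)%R]mulrC !mulrzA -mulrzDl -ze.
  have zn : a j *~ (n * n) + a i *~ (m * n) = z *~ n.
    by rewrite !mulrzA -mulrzDl addrC -ze.
  have mulz_ffun (F : {ffun I -> A}) (b : int) k : (F *~ b) k = F k *~ b.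
    by case: b => b; rewrite ?NegzE ?mulrNz -?pmulrn ?ffunE ffunMnE.
  apply/ffunP=> k; rewrite /M !(ffunE, mulz_ffun).
  have [->|ki] := eqVneq k i.
    rewrite (negPf ij) mul0rz !addr0 zm -mulrzA mulrC mulrzA -ai mulr2n mulrzDr.
    by rewrite addrAC addrK -ze.
  case: eqP => [_|_]; last by rewrite !(mul0rz, addr0, oppr0).
  by rewrite !(mul0rz, add0r) zn -mulrzA mulrC mulrzA -ai subrr.
apply: stableD; first by apply: stableD; apply: stableMz.
by apply/stableN/stableMz; do 2?apply: stableD; apply: stableMz.
Qed.

Definition subgroup_pred (S : A -> Prop) := S 0 /\ forall x y, S x -> S y -> S (x - y).

Lemma subgroup_predN S x : subgroup_pred S -> S x -> S (- x).
Proof. by case=> S0 SB Sx; rewrite -sub0r; apply: SB. Qed.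

Lemma subgroup_predD S x y : subgroup_pred S -> S x -> S y -> S (x + y).
Proof.
move=> SS Sx Sy; have [_ SB] := SS; rewrite -[y]opprK.
by apply: SB => //; apply: (@subgroup_predN S).
Qed.

(** The subgroup generated by the weights [a] on the component of [i] is
    represented by the family of all subgroups [S] that contain these weights. *)
Definition contains_weights f a i (S : A -> Prop) :=
  subgroup_pred S /\ forall k, connected f i k -> S (a k).

(** A congruence saying that the weight of an arrow is a difference of potentials
    extends from the factors to all paths. *)
Lemma potential_gen f a (phi : I -> A) :
    (forall t i S, t \in f -> contains_weights f a i S ->
       S (wt t i - phi (act t i) + phi i)) ->
  forall i j x S, linked f i j x -> contains_weights f a i S ->
    S (x - phi j + phi i).
Proof.
move=> gen i j x S fij; have transfer k l T :
    connected f k l -> contains_weights f a l T -> contains_weights f a k T.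
  move=> kl [ST Tl]; split=> // m km; apply: Tl.
  exact: connected_trans (connected_sym kl) km.
elim: fij => {i j x} [t i t_f|i|i j x ij IH|i j k x y ij IHij jk IHjk] Sw.
- exact: gen.
- by rewrite sub0r addNr; case: Sw => -[].
- have Si : contains_weights f a i S by apply: transfer Sw; exists x.
  have -> : - x - phi i + phi j = - (x - phi j + phi i).
    by rewrite !opprD !opprK addrAC.
  by apply: (@subgroup_predN S); [case: Sw | apply: IH].
- have Sj : contains_weights f a j S.
    by apply: transfer Sw; apply: connected_sym; exists x.
  rewrite (_ : _ + _ = (x - phi j + phi i) + (y - phi k + phi j)).
    by apply: (@subgroup_predD S); [case: Sw | apply: IHij | apply: IHjk].
  by rewrite [RHS]addrC addrA [in RHS]addrACA subrr addr0 [y - _ + x]addrAC [y + x]addrC.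
Qed.

(** By induction on the length.  A double edge at [i0] has weights x and x - a_i0,
    which are congruent modulo the weights, so the potential of the tail extends
    to [i0]. *)
Lemma exists_potential f a : minimal f -> gprod f = diag a ->
  exists phi : I -> A, forall i j x S, linked f i j x ->
    contains_weights f a i S -> S (x - phi j + phi i).
Proof.
have [n] := ubnP (size f); elim: n f a => // n IHn f a.
rewrite ltnS => le_n min_f fa.
have [f0|f0] := eqVneq f [::].
  by exists (fun=> 0); refine (@potential_gen f a (fun=> 0) _) => t i S; rewrite f0.
have [i0 ai0] := exists_weight min_f fa f0.
have move_hur h phi : hurwitz f h ->
    (forall t i S, t \in h -> contains_weights f a i S ->
       S (wt t i - phi (act t i) + phi i)) ->
  exists phi : I -> A, forall i j x S, linked f i j x ->
    contains_weights f a i S -> S (x - phi j + phi i).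
- move=> fh gen; exists phi => i j x S /(hur_linked _ _ _ fh) hij Sw.
  have to_f k T : contains_weights h a k T -> contains_weights f a k T.
    by case=> ST Th; split=> // l /(hur_connected _ _ fh)/Th.
  refine (potential_gen (phi := phi) (a := a) _ hij _) => [t k T th Tw|].
    by apply: gen => //; apply: to_f.
  by case: Sw => SS Sf; split=> // k /(hur_connected _ _ fh)/Sf.
case: (minimal_diag_vertex P_add i0 min_f fa) => [h ai|h _ fh h_i|j x h _ ij fh h_i].
- by rewrite ai eqxx in ai0.
- have min_h : minimal h.
    by apply: (@minimal_catr _ _ _ [:: _]); apply: minimal_hur fh min_f.
  have ha := loop_tail h_i (etrans (esym (hur_gprod fh)) fa).
  have [|phi phiP] := IHn h _ _ min_h ha; first by move: le_n; rewrite (hur_size fh).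
  apply: (move_hur _ phi fh) => t i S; rewrite inE => /orP[/eqP->|th] [SS Sf].
    rewrite act_diag subrK wt_drefl; case: eqP => [<-|_]; last by case: SS.
    by apply: Sf; apply: connected_refl.
  apply: phiP; first exact: LinkGen.
  split=> // k hik; rewrite !ffunE; case: eqP => [->|_].
    by rewrite subrr; case: SS.
  rewrite subr0; apply/Sf/(hur_connected _ _ fh).
  by apply: connected_subset hik => u; rewrite inE orbC => ->.
have min_h : minimal h.
  by apply: (@minimal_catr _ _ _ [:: _; _]); apply: minimal_hur fh min_f.
have ha := pair_tail ij h_i (etrans (esym (hur_gprod fh)) fa).
have [|phi phiP] := IHn h _ _ min_h ha.
  by move: le_n; rewrite (hur_size fh) => /ltnW.
pose phi' k := if k == i0 then phi j - x else phi k.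
have ji : (j == i0) = false by rewrite eq_sym (negPf ij).
have fij : connected f i0 j.
  apply/(hur_connected _ _ fh); have := @connected_gen _ _
    [:: trefl i0 j x, trefl i0 j (x - a i0) & h] (trefl i0 j x) i0.
  by rewrite act_trefl tpermL inE eqxx; apply.
apply: (move_hur _ phi' fh) => t i S th [SS Sf].
have t_edge y : (connected f i i0 -> S (y - x)) ->
    S (wt (trefl i0 j y) i - phi' (act (trefl i0 j y) i) + phi' i).
  move=> Syx; rewrite /phi' wt_trefl act_trefl.
  case: tpermP Sf Syx => [->|->|/eqP/negPf n1 /eqP/negPf n2] Sf Syx.
  - by rewrite ji !eqxx addrA subrK; apply/Syx/connected_refl.
  - rewrite ji !eqxx.
    have -> : - y - (phi j - x) + phi j = - (y - x).
      by rewrite !opprD !opprK addrAC addrA addrK.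
    by apply: (@subgroup_predN S) => //; apply/Syx/connected_sym.
  - by rewrite n1 n2 sub0r addNr; case: SS.
move: th; rewrite !inE => /or3P[/eqP->|/eqP->|th].
- by apply: t_edge; rewrite subrr; case: SS.
- apply: t_edge => /Sf; rewrite addrAC subrr sub0r; exact: (@subgroup_predN S).
case/andP: (allP h_i _ th) => /eqP ti /eqP wi.
have [->|ii0] := eqVneq i i0; first by rewrite ti wi sub0r addNr; case: SS.
have tii0 : act t i != i0 by rewrite -ti (inj_eq (@act_inj _ _ t)).
rewrite /phi' (negPf ii0) (negPf tii0); apply: phiP; first exact: LinkGen.
split=> // k hik; have fik : connected f i k.
  apply/(hur_connected _ _ fh); apply: connected_subset hik => u.
  by rewrite !inE => ->; rewrite !orbT.
have ki0 : k != i0.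
  apply: contraNneq ii0 => e; rewrite e in hik.
  by rewrite (connected_fixed h_i (connected_sym hik)).
rewrite !ffunE (negPf ki0) subr0; case: eqP => [kj|_]; last first.
  by rewrite addr0; apply: Sf.
apply: (@subgroup_predD S) => //; apply: Sf => //.
apply: connected_trans fik _; rewrite kj; exact: connected_sym.
Qed.

(** * The groupoid determines the orbit *)

Lemma linked_conjs f d i j x :
  linked f i j x -> linked (conjs (diag d) f) i j (x + d j - d i).
Proof.
elim=> {i j x} [t i t_f|i|i j x _|i j k x y _ ij _ jk].
- have := @LinkGen _ _ (conjs (diag d) f) (t ^ diag d)%g i (map_f _ t_f).
  rewrite conjgE -diagN !actM !wtM !act_diag !wt_diag ffunE.
  by rewrite [- d i + _]addrC.
- by rewrite add0r subrr; apply: LinkId.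
- by move=> /LinkSym; rewrite !opprD !opprK addrAC.
- have -> : x + y + d k - d i = (x + d j - d i) + (y + d k - d j).
    rewrite [x + _ - _]addrAC [RHS]addrC [RHS]addrACA addNr addr0.
    by rewrite [RHS]addrC addrA [x - _ + y]addrAC [RHS]addrAC.
  exact: LinkTrans jk.
Qed.

Lemma stable_const f d : (forall i j, connected f i j -> d i = d j) -> conj_stable f d.
Proof.
move=> d_const; suff e : conjs (diag d) f = f by rewrite /conj_stable e; apply: hur_refl.
rewrite -[RHS]map_id; apply/eq_in_map => t t_f; rewrite conjgE -diagN.
apply: monoP => k; rewrite !(actM, wtM, act_diag) // !wt_diag ffunE.
by rewrite (d_const _ _ (connected_gen k t_f)) addrC addrK.
Qed.

Lemma stable_sum f (r : seq I) (F : I -> {ffun I -> A}) :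
  (forall i, conj_stable f (F i)) -> conj_stable f (\sum_(i <- r) F i).
Proof.
move=> fF; elim/big_ind: _ => //; [exact: stable0 | exact: stableD].
Qed.

(** By [hur_diag_conj] the factorization [f'] is equivalent to the conjugate of
    [f] by some [d].  Conjugation adds d_j - d_i to the weights of paths from [i]
    to [j].  As the groupoids agree, this difference is a combination of weights
    of the component, and [stable_cross] applies to it. *)
Lemma hur_of_linked_diag f f' a :
    minimal f -> minimal f' -> gprod f = diag a -> gprod f' = diag a ->
    (forall i j x, linked f i j x <-> linked f' i j x) ->
  hurwitz f f'.
Proof.
move=> min_f min_f' fa f'a ff'.
have cff' i j : connected f i j <-> connected f' i j.
  by split=> -[x /ff' ij]; exists x.
have [d f'd] := hur_diag_conj P_add min_f min_f' fa f'a cff'.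
suff fd : conj_stable f d by apply: (hur_trans fd); apply: hur_sym.
have [phi phiP] := exists_potential min_f fa.
have d_shift i j : connected f i j -> conj_stable f (single i (d j - d i)).
  move=> [x ij]; pose S c := conj_stable f (single i c).
  have Sw : contains_weights f a i S.
    split=> [|k ik]; last exact: stable_cross ik min_f fa.
    split=> [|x' y Sx Sy]; first by rewrite /S single0; apply: stable0.
    by rewrite /S single_add singleN; apply: stableD => //; apply: stableN.
  have ij' : linked f i j (x + d j - d i).
    by apply/ff'/(hur_linked _ _ _ f'd)/linked_conjs.
  have [SS _] := Sw.
  have := SS.2 _ _ (phiP _ _ _ _ ij' Sw) (phiP _ _ _ _ ij Sw).
  have -> : x + d j - d i - phi j + phi i = (d j - d i) + (x - phi j + phi i).
    by rewrite !addrA [x + _]addrC [d j + x - _]addrAC.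
  by rewrite addrK.
pose root i := odflt i [pick k | `[< connected f i k >]].
have root_conn i : connected f i (root i).
  rewrite /root; case: pickP => [k /asboolP //|_]; exact: connected_refl.
have root_eq i j : connected f i j -> root i = root j.
  move=> ij; rewrite /root.
  have e : (fun k => `[< connected f i k >]) =1
           (fun k => `[< connected f j k >]).
    move=> k; apply: asbool_equiv_eq; split; apply: connected_trans => //.
    exact: connected_sym.
  rewrite (eq_pick e); case: pickP => // /(_ j) /asboolP; case; exact: connected_refl.
(* The first summand is constant on components, and the others are multiples of
   unit vectors covered by [d_shift]. *)
have -> : d = [ffun i => d (root i)] + \sum_i single i (d i - d (root i)).
  apply/ffunP=> k; rewrite !ffunE sum_ffunE (bigD1 k) //= big1 => [|i ik].
    by rewrite ffunE eqxx addr0 addrC subrK.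
  by rewrite ffunE eq_sym (negPf ik).
apply: stableD.
  by apply: stable_const => i j ij; rewrite !ffunE (root_eq i j).
apply: stable_sum => i; rewrite -opprB singleN.
by apply/stableN/d_shift/root_conn.
Qed.

(** The edge is the only factor that touches [i], so a path between two other
    indices can be folded into the tail without a change of weight. *)
Lemma sub_linked_edge_tail i j x h h' : i != j ->
    all (fixes i) h -> all (fixes i) h' ->
    (forall k l y, linked (trefl i j x :: h) k l y ->
                   linked (trefl i j x :: h') k l y) ->
  forall k l y, linked h k l y -> linked h' k l y.
Proof.
move=> ij h_i h'_i sub k l y hkl; have [e y0] := linked_fixed h_i hkl.
have [ki|ki] := eqVneq k i.
  move: e; rewrite ki eqxx y0 // => /esym/eqP->; exact: LinkId.
have li : l != i by rewrite -e.
pose kappa m := if m == i then x else 0.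
have := @linked_retract _ _ (fold i j) kappa [:: trefl i j x] h' i k l y.
rewrite /kappa /fold (negPf ki) (negPf li) subr0 addr0; apply=> //.
- move=> t m; rewrite inE => /eqP->; split; first exact: fold_trefl.
  rewrite wt_trefl act_trefl; case: tpermP => [->|->|/eqP/negPf mi /eqP/negPf mj].
  + by rewrite eqxx [j == i]eq_sym (negPf ij) subr0.
  + by rewrite !eqxx [j == i]eq_sym (negPf ij) sub0r.
  + by rewrite mi mj subrr.
- by move=> m /negPf->.
apply: sub; apply: linked_subset hkl => t; rewrite inE orbC => -> //.
Qed.

(** A nondiagonal product forces the same first edge in both factorizations; the
    tails have the same groupoid, and one reduces to a diagonal product. *)
Theorem hur_of_linked f f' :
    minimal f -> minimal f' -> gprod f = gprod f' ->
    (forall i j x, linked f i j x <-> linked f' i j x) ->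
  hurwitz f f'.
Proof.
have [n] := ubnP (size f); elim: n f f' => // n IHn f f'.
rewrite ltnS => le_n min_f min_f' e ff'.
have [/existsP[j gj]|/existsPn g_diag] := boolP [exists j, act (gprod f) j != j].
  set i := act (gprod f) j in gj.
  have [h fh h_i] := minimal_edge P_add min_f (erefl i) gj.
  have gj' : act (gprod f') j = i by rewrite -e.
  have [h' fh' h'_i] := minimal_edge P_add min_f' gj' gj.
  move: fh'; rewrite -e; move: fh; set x := - wt _ j => fh fh'.
  apply: (hur_trans fh); apply: hur_trans (hur_sym fh').
  have linked_fh k l y := hur_linked k l y fh.
  have linked_fh' k l y := hur_linked k l y fh'.
  apply: (@hur_catl _ [:: _]); apply: IHn.
  - by move: le_n; rewrite (hur_size fh).
  - by apply: (@minimal_catr _ _ _ [:: _]); apply: minimal_hur fh min_f.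
  - by apply: (@minimal_catr _ _ _ [:: _]); apply: minimal_hur fh' min_f'.
  - apply: (mulgI (trefl i j x)); rewrite -!gprod_cons.
    by rewrite -(hur_gprod fh) -(hur_gprod fh').
  - split; apply: (@sub_linked_edge_tail i j x) => // k' l' y'.
      by move/linked_fh/ff'/linked_fh'.
    by move/linked_fh'/ff'/linked_fh.
have fa : gprod f = diag (mweight (gprod f)).
  by apply: monoP => // k; rewrite act_diag; apply/eqP; have := g_diag k; rewrite negbK.
by apply: (hur_of_linked_diag min_f min_f' fa) => //; rewrite -e.
Qed.

End Stabilizer.

(** * Monomial matrices *)

Section Monomial.
Local Open Scope ring_scope.
Variables (K : fieldType) (m p n : nat) (A : zmodType) (e : A -> K).
Hypothesis eD : forall x y, e (x + y) = e x * e y.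
Hypothesis e0 : e 0 = 1.
Hypothesis e_inj : injective e.
Hypothesis e_root : forall x, e x ^+ m = 1.
Hypothesis root_e : forall c, c ^+ m = 1 -> exists x, c = e x.
Local Notation W := (mono 'I_n A).
Local Notation G := (Gmpn K m p n).
Implicit Types (v w : W) (i j k : 'I_n) (x y : A) (F H : seq W).

Lemma e_neq0 x : e x != 0.
Proof.
apply/eqP=> ex0; have := eD x (- x).
by rewrite subrr e0 ex0 mul0r => /eqP; rewrite oner_eq0.
Qed.

Definition rep w : 'M[K]_n :=
  \matrix_(i, j) if j == act w i then e (wt w i) else 0.

Lemma rep_neq0 w i j : (rep w i j != 0) = (j == act w i).
Proof. by rewrite mxE; case: (j == _); rewrite ?e_neq0 ?eqxx. Qed.

Lemma rep_act w i : rep w i (act w i) = e (wt w i).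
Proof. by rewrite mxE eqxx. Qed.

Lemma rep_mulE q w (X : 'M[K]_(n, q)) i (l : 'I_q) :
  (rep w *m X) i l = e (wt w i) * X (act w i) l.
Proof.
rewrite mxE (bigD1 (act w i)) //= big1 => [|k /negPf ki].
  by rewrite rep_act addr0.
by rewrite mxE ki mul0r.
Qed.

Lemma repM u v : rep (u * v)%g = rep u *m rep v.
Proof.
apply/matrixP=> i j; rewrite rep_mulE !mxE actM wtM eD.
by case: eqP => _; rewrite ?mulr0.
Qed.

Lemma rep1 : rep 1%g = 1%:M.
Proof.
by apply/matrixP=> i j; rewrite !mxE act1 wt1 e0 eq_sym; case: eqP.
Qed.

Lemma rep_inj : injective rep.
Proof.
move=> u v uv; have uvE i : act u i = act v i.
  by apply/eqP; rewrite -(rep_neq0 v) -uv rep_neq0.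
apply: monoP => // i; apply: e_inj.
by rewrite -!rep_act uvE uv.
Qed.

Lemma rep_unit w : rep w \in unitmx.
Proof.
by have /mulmx1_unit[] : rep w *m rep w^-1%g = 1%:M by rewrite -repM mulgV rep1.
Qed.

Lemma repV w : rep w^-1%g = invmx (rep w).
Proof.
apply: (can_inj (mulKmx (rep_unit w))).
by rewrite mulmxV ?rep_unit // -repM mulgV rep1.
Qed.

Lemma rep_conj t u : rep (t ^ u)%g = invmx (rep u) *m rep t *m rep u.
Proof. by rewrite conjgE !repM repV mulmxA. Qed.

Lemma mx_prod_rep F : mx_prod [seq rep w | w <- F] = rep (gprod F).
Proof.
elim: F => [|w F IHF]; first by rewrite /mx_prod big_nil gprod_nil rep1.
by rewrite /mx_prod /= big_cons gprod_cons repM -IHF.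
Qed.

Definition diag_values : pred A := fun x => e x ^+ (m %/ p) == 1.

Lemma diag_valuesD x y : diag_values x -> diag_values y -> diag_values (x + y).
Proof. by rewrite /diag_values eD exprMn => /eqP-> /eqP->; rewrite mulr1. Qed.

Definition total w := \sum_i wt w i.

Lemma e_sum (F : 'I_n -> A) : e (\sum_i F i) = \prod_i e (F i).
Proof. exact: (big_morph e eD e0). Qed.

Lemma totalM u v : total (u * v)%g = total u + total v.
Proof.
rewrite /total (eq_bigr _ (fun i _ => wtM u v i)) big_split /=; congr (_ + _).
by rewrite [RHS](reindex_inj (@act_inj _ _ u)).
Qed.

Lemma total1 : total 1%g = 0.
Proof. by rewrite /total big1 // => i _; rewrite wt1. Qed.

Lemma totalV u : total u^-1%g = - total u.
Proof. by apply/eqP; rewrite -addr_eq0 -totalM mulVg total1. Qed.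

Lemma prod_rep w :
  \prod_i \prod_(j | rep w i j != 0) rep w i j = e (total w).
Proof.
rewrite e_sum; apply: eq_bigr => i _.
rewrite (eq_bigl (pred1 (act w i))) => [|j]; last exact: rep_neq0.
by rewrite big_pred1_eq rep_act.
Qed.

Lemma rep_in_Gmpn w : G (rep w) <-> diag_values (total w).
Proof.
split; first by case=> _ _; rewrite prod_rep => /eqP.
move=> Pw; split; last by rewrite prod_rep; apply/eqP.
  split=> [i|j].
    exists (act w i); split; first by rewrite rep_neq0.
    by move=> j; rewrite rep_neq0 => /eqP.
  exists (act w^-1%g j); split; first by rewrite rep_neq0 actKV.
  by move=> i; rewrite rep_neq0 => /eqP->; rewrite actK.
by move=> i j; rewrite rep_neq0 => /eqP->; rewrite rep_act.
Qed.

Lemma Gmpn_rep B : G B -> exists w, B = rep w.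
Proof.
case=> [[B_row B_col] B_root _].
have [s sP] := choice B_row.
have s_inj : injective s.
  move=> i i' e_s; have [k [_ k_uniq]] := B_col (s i).
  by rewrite -(k_uniq i (sP i).1) -(k_uniq i') // e_s; exact: (sP i').1.
have [a aP] := choice (fun i => root_e (B_root _ _ (sP i).1)).
exists (Mono (perm s_inj) [ffun i => a i]); apply/matrixP=> i j.
rewrite mxE /act /wt permE ffunE /=; case: eqP => [->|js]; first exact: aP.
by apply/eqP; apply: contra_notT js => /((sP i).2 j)->.
Qed.

Lemma Gmpn1 : G 1%:M.
Proof.
by rewrite -rep1; apply/rep_in_Gmpn; rewrite total1 /diag_values e0 expr1n.
Qed.

Lemma GmpnM B C : G B -> G C -> G (B *m C).
Proof.
move=> GB GC; have [[u uE] [v vE]] := (Gmpn_rep GB, Gmpn_rep GC).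
move: GB GC; rewrite uE vE -repM !rep_in_Gmpn totalM; exact: diag_valuesD.
Qed.

Lemma GmpnV B : G B -> G (invmx B).
Proof.
move=> GB; have [u uE] := Gmpn_rep GB.
move: GB; rewrite uE -repV !rep_in_Gmpn totalV /diag_values => /eqP ueq.
have := congr1 (fun c => c ^+ (m %/ p)) (eD (total u) (- total u)).
by rewrite subrr e0 expr1n exprMn ueq mul1r => <-.
Qed.

Lemma Gmpn_unit B : G B -> B \in unitmx.
Proof. by case/Gmpn_rep => w ->; apply: rep_unit. Qed.

(** * Reflections among monomial matrices *)

(** The hyperplane condition on fixed vectors says that this map has rank 1. *)
Definition displacement w : 'End('cV[K]_n) := (linfun (mulmx (rep w)) - \1)%VF.

Lemma displacementE w (X : 'cV[K]_n) i :
  displacement w X i 0 = e (wt w i) * X (act w i) 0 - X i 0.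
Proof.
by rewrite add_lfunE opp_lfunE id_lfunE lfunE /= mxE [X in _ + X]mxE rep_mulE.
Qed.

Lemma is_reflectionP w :
  is_reflection (rep w) <-> \dim (limg (displacement w)) = 1%N.
Proof.
have := limg_ker_dim (displacement w) fullv; rewrite capfv dimvf /dim /= muln1.
rewrite /is_reflection -/(displacement w).
rewrite /fixedSpace -/(displacement w).
by set d := \dim _; set d' := \dim _; lia.
Qed.

(** A displacement of rank 1 has vanishing minors, written on unit vectors. *)
Lemma reflection_minor w i j k l : is_reflection (rep w) ->
  let D a b := e (wt w a) * (act w a == b)%:R - (a == b)%:R in
  D i j * D k l = D i l * D k j.
Proof.
move/is_reflectionP=> dim1 D.
set X := vpick (limg (displacement w)).
have X0 : X != 0 by rewrite vpick0 -dimv_eq0 dim1.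
have limgE : limg (displacement w) = <[X]>%VS.
  apply/esym/eqP; rewrite eqEdim dim1 dim_vline X0 andbT -memvE.
  exact: memv_pick.
have DE a b : D a b = displacement w (delta_mx b 0) a 0.
  by rewrite displacementE !mxE eqxx !andbT.
have line b : exists c, displacement w (delta_mx b 0) = c *: X.
  by apply/vlineP; rewrite -limgE memv_img // memvf.
have [[c cE] [d dE]] := (line j, line l).
by rewrite !DE cE dE !mxE mulrACA [RHS]mulrACA [c * d]mulrC [X i 0 * _]mulrC mulrC.
Qed.

Lemma rank1_reflection w (X : 'cV[K]_n) :
    (forall Y, exists c, displacement w Y = c *: X) ->
    (exists Y, displacement w Y != 0) ->
  is_reflection (rep w).
Proof.
move=> line [Y Y0]; apply/is_reflectionP/eqP; rewrite eqn_leq; apply/andP; split.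
  apply: leq_trans (_ : \dim <[X]> <= 1)%N; last by rewrite dim_vline leq_b1.
  apply/dimvS/subvP=> _ /memv_imgP[Z _ ->]; apply/vlineP; exact: line.
rewrite lt0n dimv_eq0; apply: contraNneq Y0 => e0'.
by rewrite -memv0 -e0' memv_img // memvf.
Qed.

Lemma total_trefl i j x : i != j -> total (trefl i j x) = 0.
Proof.
move=> ij; rewrite /total (bigD1 i) //= (bigD1 j) 1?eq_sym //= big1 => [|k /andP[ki kj]].
  by rewrite !wt_trefl !eqxx [j == i]eq_sym (negPf ij) addr0 subrr.
by rewrite wt_trefl (negPf ki) (negPf kj).
Qed.

Lemma total_drefl i x : total (drefl i x) = x.
Proof.
rewrite /total (bigD1 i) //= big1 => [|k /negPf ki].
  by rewrite wt_drefl eqxx addr0.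
by rewrite wt_drefl ki.
Qed.

(** If [w] moves [i], the minors through the entry (i, i) show that [w] fixes
    every index apart from [i] and its image [j], and the minor on rows and
    columns [i], [j] makes the two weights opposite. *)
Lemma reflection_refl w :
  is_reflection (rep w) -> G (rep w) -> refl diag_values w.
Proof.
move=> Rw /rep_in_Gmpn Pw.
have diagD0 k : (e (wt w k) * (act w k == k)%:R - (k == k)%:R == 0) = fixes k w.
  rewrite /fixes eqxx; case: (act w k =P k) => _ /=; last first.
    by rewrite mulr0n mulr0 sub0r oppr_eq0 oner_eq0.
  by rewrite !mulr1n mulr1 subr_eq0 -[X in _ == X]e0 (inj_eq e_inj).
have fixes_off i k : moves i w -> act w i != k -> i != k -> fixes k w.
  rewrite /moves -!diagD0 => Di /negPf wik /negPf ik.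
  have /eqP := reflection_minor i i k k Rw.
  by rewrite /= wik ik !mulr0n mulr0 subrr mul0r mulf_eq0 (negPf Di).
have [/existsP[i wi]|/existsPn w_diag] := boolP [exists i, act w i != i].
  pose j := act w i; have ij : i != j by rewrite eq_sym.
  have off k : k != i -> k != j -> fixes k w.
    by move=> ki kj; apply: (@fixes_off i); rewrite 1?eq_sym // /moves /fixes (negPf wi).
  have wj_j : act w j != j by rewrite (inj_eq (@act_inj _ _ w)).
  have wj : act w j = i.
    apply/eqP; apply: contraNT wj_j => wj_i; apply/eqP/(@act_inj _ _ w).
    have [e1|wj_j] := eqVneq (act w j) j; first by rewrite !e1.
    by case/andP: (off _ wj_i wj_j) => /eqP.
  left; exists i, j, (wt w i); split=> //.
  have wij : wt w j = - wt w i.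
    apply: e_inj; have := reflection_minor i i j j Rw.
    rewrite /= wj -/j !eqxx (negPf ij) [j == i]eq_sym (negPf ij).
    rewrite !mulr0n !mulr0 !sub0r !subr0 !mulr1.
    rewrite !mulr1n mulrNN mulr1 -e0 -(subrr (wt w i)) eD.
    by move/(mulfI (e_neq0 _)).
  apply: monoP => k.
    rewrite act_trefl; case: tpermP => [->|->|/eqP ki /eqP kj] //.
    by case/andP: (off k ki kj) => /eqP.
  rewrite wt_trefl; case: eqVneq => [->|ki] //; case: eqVneq => [->|kj] //.
  by case/andP: (off k ki kj) => _ /eqP.
have wE k : act w k = k by apply/eqP; have := w_diag k; rewrite negbK.
have [/existsP[i wi]|/existsPn w0] := boolP [exists i, wt w i != 0]; last first.
  have w1 : w = 1%g.
    apply: monoP => k; first by rewrite act1 wE.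
    by rewrite wt1; apply/eqP; have := w0 k; rewrite negbK.
  move/is_reflectionP: Rw; rewrite w1.
  suff -> : displacement 1%g = 0 by rewrite lim0g dimv0.
  apply/lfunP=> Y; apply/colP=> k.
  by rewrite displacementE act1 wt1 e0 mul1r subrr lfunE mxE.
have wD : w = drefl i (wt w i).
  apply: monoP => k; first by rewrite act_diag wE.
  rewrite wt_drefl; case: eqVneq => [->|ki] //.
  have /andP[_ /eqP //] : fixes k w.
  by apply: (@fixes_off i); rewrite ?wE 1?eq_sym // /moves /fixes (negPf wi) andbF.
right; exists i, (wt w i); split=> //.
by rewrite wD total_drefl in Pw.
Qed.

Lemma refl_reflection w : refl diag_values w -> is_reflection (rep w).
Proof.
case=> [[i [j [x [ij ->]]]]|[i [x [Px x0 ->]]]].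
  apply: (@rank1_reflection _ (delta_mx i 0 - e (- x) *: delta_mx j 0)).
    move=> Y; exists (e x * Y j 0 - Y i 0); apply/colP=> k.
    rewrite displacementE !mxE eqxx !andbT wt_trefl act_trefl.
    case: tpermP => [->|->|/eqP/negPf ki /eqP/negPf kj].
    - by rewrite eqxx (negPf ij) mulr0 subr0 mulr1.
    - rewrite eqxx eq_sym (negPf ij) sub0r mulr1 mulrN mulrBl mulrAC -eD subrr e0.
      by rewrite mul1r opprB mulrC.
    - by rewrite ki kj e0 mul1r subrr mulr0 subr0 mulr0.
  exists (delta_mx i 0); apply/eqP => /colP/(_ i)/eqP.
  rewrite displacementE !mxE act_trefl tpermL [j == i]eq_sym (negPf ij).
  rewrite !eqxx /= mulr0 sub0r.
  by rewrite oppr_eq0 oner_eq0.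
apply: (@rank1_reflection _ (delta_mx i 0)).
  move=> Y; exists (e x * Y i 0 - Y i 0); apply/colP=> k.
  rewrite displacementE !mxE eqxx !andbT wt_drefl act_diag.
  by case: eqP => [->|_]; rewrite ?mulr1 // e0 mul1r subrr mulr0.
exists (delta_mx i 0); apply/eqP => /colP/(_ i)/eqP.
rewrite displacementE !mxE act_diag wt_drefl !eqxx /= mulr1 subr_eq0 -e0.
by rewrite (inj_eq e_inj) (negPf x0).
Qed.

Lemma refl_in_Gmpn w : refl diag_values w -> G (rep w).
Proof.
move=> Rw; apply/rep_in_Gmpn; case: Rw => [[i [j [x [ij ->]]]]|[i [x [Px x0 ->]]]].
  by rewrite total_trefl // /diag_values e0 expr1n.
by rewrite total_drefl.
Qed.

(** * Transfer to matrix factorizations *)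

Lemma same_orbit_rep F H :
  hurwitz F H -> same_hurwitz_orbit (map rep F) (map rep H).
Proof.
move: F H; apply: hur_ind => [F|F H|F H H'|s1 s2 t u].
- exact: rst_refl.
- exact: rst_sym.
- exact: rst_trans.
- by rewrite !map_cat /= rep_conj; apply/rst_step/HurwitzMove.
Qed.

Lemma lift_reflections (f : seq 'M[K]_n) :
  (forall t, t \in f -> G t /\ is_reflection t) ->
  exists2 F, refls diag_values F & f = map rep F.
Proof.
elim: f => [|t f IHf] tf; first by exists [::].
have [|F RF fE] := IHf; first by move=> u uf; apply: tf; rewrite inE uf orbT.
have [Gt Rt] := tf t (mem_head _ _); have [w tE] := Gmpn_rep Gt.
exists (w :: F); last by rewrite /= -tE fE.
by apply/refls_cons; split=> //; apply: reflection_refl; rewrite -tE.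
Qed.

Lemma lift_min_factorization (g : 'M[K]_n) f : min_refl_factorization G g f ->
  exists F, [/\ minimal diag_values F, f = map rep F & rep (gprod F) = g].
Proof.
case=> [[Rf fg] min_f]; have [F RF fE] := lift_reflections Rf.
have gE : rep (gprod F) = g by rewrite -mx_prod_rep -fE.
exists F; split=> //; split=> // H RH FH.
have := min_f (map rep H); rewrite fE !size_map; apply; split.
  by move=> _ /mapP[t /RH Rt ->]; split; [apply: refl_in_Gmpn | apply: refl_reflection].
by rewrite mx_prod_rep FH.
Qed.

Local Notation gen := (generated_subgroup G).

Lemma sub_generated (f h : seq 'M[K]_n) :
  (forall t, t \in f -> gen h t) -> forall t, gen f t -> gen h t.
Proof.
move=> fh t ft H [GH hH].
apply: (ft H); split=> // u uf; exact: fh.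
Qed.

Lemma generatedM (f : seq 'M[K]_n) B C : gen f B -> gen f C -> gen f (B *m C).
Proof.
by move=> fB fC H [GH fH]; have [_ _ M _] := GH; apply: M; [apply: fB|apply: fC].
Qed.

Lemma generatedV (f : seq 'M[K]_n) B : gen f B -> gen f (invmx B).
Proof. by move=> fB H [GH fH]; have [_ _ _ V] := GH; apply: V; apply: fB. Qed.

Lemma generated_mem (f : seq 'M[K]_n) t : t \in f -> gen f t.
Proof. by move=> tf H [_ fH]; apply: fH. Qed.

(** Membership in G(m,p,n) is carried along because no subgroup at all contains a
    tuple with an entry outside of it. *)
Lemma move_generated (f h : seq 'M[K]_n) : hurwitz_move f h ->
  ((forall t, t \in f -> G t) <-> (forall t, t \in h -> G t)) /\
  ((forall t, t \in f -> G t) -> gen f = gen h).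
Proof.
case=> s1 s2 t u; set f0 := s1 ++ _; set h0 := s1 ++ _.
have Guconj : G u -> G (invmx u *m t *m u) -> G t.
  move=> Gu Gc; have := GmpnM (GmpnM Gu Gc) (GmpnV Gu).
  by rewrite !mulmxA mulmxV ?mul1mx -?mulmxA ?mulmxV ?mulmx1 ?Gmpn_unit.
split.
  split=> Gf v; rewrite mem_cat !inE => /orP[v1|/or3P[/eqP->|/eqP->|v2]].
  - by apply: Gf; rewrite mem_cat v1.
  - by apply: Gf; rewrite mem_cat !inE eqxx !orbT.
  - apply: GmpnM; [apply: GmpnM; first apply: GmpnV|];
      by apply: Gf; rewrite mem_cat !inE eqxx !orbT.
  - by apply: Gf; rewrite mem_cat !inE v2 !orbT.
  - by apply: Gf; rewrite mem_cat v1.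
  - by apply: Guconj; apply: Gf; rewrite mem_cat !inE eqxx !orbT.
  - by apply: Gf; rewrite mem_cat !inE eqxx !orbT.
  - by apply: Gf; rewrite mem_cat !inE v2 !orbT.
move=> Gf; have Gu : G u by apply: Gf; rewrite mem_cat !inE eqxx !orbT.
apply/seteqP; split; apply: sub_generated => v;
  rewrite mem_cat !inE => /orP[v1|/or3P[/eqP->|/eqP->|v2]].
- by apply: generated_mem; rewrite mem_cat v1.
- have -> : t = u *m (invmx u *m t *m u) *m invmx u.
    by rewrite !mulmxA mulmxV ?mul1mx -?mulmxA ?mulmxV ?mulmx1 ?Gmpn_unit.
  apply: generatedM; [apply: generatedM|apply: generatedV];
    by apply: generated_mem; rewrite mem_cat !inE eqxx !orbT.
- by apply: generated_mem; rewrite mem_cat !inE eqxx !orbT.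
- by apply: generated_mem; rewrite mem_cat !inE v2 !orbT.
- by apply: generated_mem; rewrite mem_cat v1.
- by apply: generated_mem; rewrite mem_cat !inE eqxx !orbT.
- apply: generatedM; [apply: generatedM; first apply: generatedV|];
    by apply: generated_mem; rewrite mem_cat !inE eqxx !orbT.
- by apply: generated_mem; rewrite mem_cat !inE v2 !orbT.
Qed.

Lemma orbit_generated (f h : seq 'M[K]_n) : same_hurwitz_orbit f h ->
  (forall t, t \in f -> G t) -> gen f = gen h.
Proof.
move=> fh; suff [_] : ((forall t, t \in f -> G t) <-> (forall t, t \in h -> G t)) /\
  ((forall t, t \in f -> G t) -> gen f = gen h) by [].
elim: fh => {f h} [f h /move_generated //|f|f h _ [Gfh fh]|f h s _ [Gfh fh] _ [Ghs hs]].
- by [].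
- by split=> [|Gh]; [rewrite Gfh | rewrite fh // Gfh].
- by split=> [|Gf]; [rewrite Gfh | rewrite fh // hs // -Gfh].
Qed.

(** The monomial matrices all of whose arrows are paths form a subgroup, which
    contains the factors. *)
Lemma generated_in_groupoid F w : (forall t, t \in map rep F -> G t) ->
  gen (map rep F) (rep w) -> in_groupoid F w.
Proof.
move=> GF; pose H := [set B | G B /\ exists2 v, B = rep v & in_groupoid F v]%classic.
move=> /(_ H) [|_ [v /rep_inj-> //]]; split.
- split.
  + by move=> B [].
  + by split; [exact: Gmpn1 | exists 1%g; rewrite ?rep1 //; apply: in_groupoid1].
  + move=> B C [GB [u uE Fu]] [GC [v vE Fv]]; split; first exact: GmpnM.
    by exists (u * v)%g; [rewrite repM uE vE | apply: in_groupoidM].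
  + move=> B [GB [u uE Fu]]; split; first exact: GmpnV.
    by exists u^-1%g; [rewrite repV uE | apply: in_groupoidV].
- move=> B BF; split; first exact: GF.
  by move/mapP: BF => [t tF ->]; exists t => // i; apply: LinkGen.
Qed.

Hypothesis bezout : forall x y, exists (z : A) (a b c d : int),
  [/\ x = z *~ a, y = z *~ b & z = x *~ c + y *~ d].

Theorem same_orbit_iff_generated (g : 'M[K]_n) (f f' : seq 'M[K]_n) :
    min_refl_factorization G g f -> min_refl_factorization G g f' ->
  same_hurwitz_orbit f f' <-> gen f = gen f'.
Proof.
move=> min_f min_f'.
have Gf t : t \in f -> G t by move=> tf; have [[/(_ t tf)[]]] := min_f.
have Gf' t : t \in f' -> G t by move=> tf; have [[/(_ t tf)[]]] := min_f'.
split=> [/orbit_generated|]; first by apply.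
have [F [min_F fE Fg]] := lift_min_factorization min_f.
have [F' [min_F' f'E F'g]] := lift_min_factorization min_f'.
rewrite {}fE {}f'E in Gf Gf' *; move=> gen_eq; apply: same_orbit_rep.
apply: (hur_of_linked diag_valuesD bezout min_F min_F').
  by apply: rep_inj; rewrite Fg.
move=> i j x; split; apply: linked_sub => t tF.
  apply: (generated_in_groupoid Gf'); rewrite -gen_eq.
  exact: generated_mem (map_f _ tF).
apply: (generated_in_groupoid Gf); rewrite gen_eq.
exact: generated_mem (map_f _ tF).
Qed.

End Monomial.

(** * Roots of unity *)

Section RootsOfUnity.
Local Open Scope ring_scope.

(** The polynomial X^m - 1 is separable, so it has m distinct roots. *)
Lemma closed_prim_root (K : closedFieldType) (m : nat) :
  (0 < m)%N -> m%:R != 0 :> K -> exists z : K, m.-primitive_root z.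
Proof.
pose q : {poly K} := 'X^m - 1; have [r Dq] := closed_field_poly_normal q.
move=> m_gt0 mK; rewrite (monicP _) ?monicXnsubC // scale1r in Dq.
have rm1 : all m.-unity_root r by apply/allP=> z; rewrite -root_prod_XsubC -Dq.
have sz_r : (m < (size r).+1)%N.
  by rewrite -(size_prod_XsubC r id) -Dq size_XnsubC.
have [|z] := hasP (has_prim_root m_gt0 rm1 _ sz_r); last by exists z.
by rewrite -separable_prod_XsubC -Dq separable_Xn_sub_1.
Qed.

(** The identity of Bezout for integers, read in the quotient Z/m; its role is to
    make the subgroup spanned by two elements cyclic. *)
Lemma ord_bezout m (x y : 'I_m.+1) : exists (z : 'I_m.+1) (a b c d : int),
  [/\ x = z *~ a, y = z *~ b & z = x *~ c + y *~ d].
Proof.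
pose o : 'I_m.+1 := inZp 1.
have oE (k : 'I_m.+1) : k = o *~ (k : nat)%:Z.
  rewrite -pmulrn Zp_mulrn; apply: val_inj.
  by rewrite /= modnMml mul1n modn_small.
have [u [v uv]] := Bezoutz (x : nat)%:Z (y : nat)%:Z.
have /dvdzP[a xa] := dvdz_gcdl (x : nat)%:Z (y : nat)%:Z.
have /dvdzP[b yb] := dvdz_gcdr (x : nat)%:Z (y : nat)%:Z.
exists (o *~ gcdz (x : nat)%:Z (y : nat)%:Z), a, b, u, v.
split.
- by rewrite [LHS]oE {1}xa mulrC mulrzA.
- by rewrite [LHS]oE {1}yb mulrC mulrzA.
- by rewrite -uv mulrzDr [u * _]mulrC [v * _]mulrC !mulrzA -!oE.
Qed.

Lemma prim_root_exp (K : fieldType) (m : nat) (z : K) :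
    m.+1.-primitive_root z ->
  let e (x : 'I_m.+1) := z ^+ x in
  [/\ forall x y, e (x + y) = e x * e y, e 0 = 1, injective e,
      forall x, e x ^+ m.+1 = 1 & forall c, c ^+ m.+1 = 1 -> exists x, c = e x].
Proof.
move=> z_prim e; split.
- by move=> x y; rewrite /e /= prim_expr_mod // exprD.
- by [].
- move=> x y /eqP; rewrite (eq_prim_root_expr z_prim) !modn_small // => /eqP.
  exact: val_inj.
- by move=> x; rewrite exprAC (prim_expr_order z_prim) expr1n.
- by move=> c /(prim_rootP z_prim)[k ->]; exists k.
Qed.

End RootsOfUnity.
Local Open Scope ring_scope.

Theorem theorem4p1 (R : realType) (m p n : nat)
    (m_gt0 : (0 < m)%N) (p_gt0 : (0 < p)%N) (n_gt0 : (0 < n)%N)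
    (p_dvd_m : (p %| m)%N) (g : 'M[R[i]]_n) (g_in_G : Gmpn R[i] m p n g)
    (f f' : seq 'M[R[i]]_n)
    (f_min : min_refl_factorization (Gmpn R[i] m p n) g f)
    (f'_min : min_refl_factorization (Gmpn R[i] m p n) g f') :
  @same_hurwitz_orbit R[i] n f f' <->
  generated_subgroup (Gmpn R[i] m p n) f =
  generated_subgroup (Gmpn R[i] m p n) f'.
Proof.
case: m m_gt0 p_dvd_m g_in_G f_min f'_min => // m _ _ _ f_min f'_min.
have [|z z_prim] := @closed_prim_root R[i] m.+1 (ltn0Sn m).
  by rewrite Num.Theory.pnatr_eq0.
have [eD e0 e_inj e_root root_e] := prim_root_exp z_prim.
exact: (same_orbit_iff_generated eD e0 e_inj e_root root_e (@ord_bezout m)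
  f_min f'_min).
Qed.
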